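(* Let $\varepsilon>0$ and let $F:\Gamma_\varepsilon\to\mathbb{R}$ be continuous. Let $u_\varepsilon$ be the unique Borel measurable function satisfying the dynamic programming principle in $\Omega_T$ with boundary data $F$ on $\Gamma_\varepsilon$, and let $u^\varepsilon$ be the value of the game with payoff $F$. Then $u_\varepsilon=u^\varepsilon$ in $\Omega_T$.
   Context: Setting: $2<p<\infty$, $T>0$, $\Omega\subset\mathbb{R}^n$ is a bounded domain satisfying a uniform exterior sphere condition (there is $\delta>0$ such that for every $y\in\partial\Omega$ there is an open ball $B_\delta\subset\mathbb{R}^n\setminus\Omega$ of radius $\delta$ with $\overline{B}_\delta\cap\overline{\Omega}=\{y\}$), $\Omega_T:=\Omega\times(0,T)$. $S_\varepsilon=\{x\in\mathbb{R}^n\setminus\Omega:\operatorname{dist}(x,\partial\Omega)\le\varepsilon\}$ and $\Gamma_\varepsilon=(S_\varepsilon\times[-\varepsilon^2,T])\cup(\Omega\times[-\varepsilon^2,0])$. Dynamic programming principle (DPP): a Borel measurable function $u_\varepsilon:\Omega_T\cup\Gamma_\varepsilon\to\mathbb{R}$ satisfies the DPP in $\Omega_T$ with boundary data $F$ if $u_\varepsilon=F$ on $\Gamma_\varepsilon$ and for all $(x,t)\in\Omega_T$ $$u_\varepsilon(x,t)=\frac{n+2}{p+n}\frac{1}{|B_\varepsilon(x)|}\int_{B_\varepsilon(x)}u_\varepsilon(y,t-\varepsilon^2)\,dy+\frac{p-2}{p+n}\sup_{|\sigma|=1}\left[\frac{u_\varepsilon(x+\varepsilon\sigma,t-\varepsilon^2)+u_\varepsilon(x-\varepsilon\sigma,t-\varepsilon^2)}{2}\right].$$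 Game: let $\alpha=\frac{p-2}{p+n}$, $\beta=\frac{n+2}{p+n}$. A token starts at $(x_0,t_0)\in\Omega_T$. A strategy $S$ is a Borel measurable rule giving at each step a unit vector $\sigma=S(t_0,x_0,\dots,x_k)\in\mathbb{R}^n$. Given positions $(x_0,t_0),\dots,(x_k,t_k)$ with $(x_k,t_k)\in\Omega_T$, the next position $(x_{k+1},t_{k+1})$, with $t_{k+1}=t_k-\varepsilon^2$, has the distribution $$A\mapsto\beta\,\frac{|A\cap(B_\varepsilon(x_k)\times\{t_k-\varepsilon^2\})|}{|B_\varepsilon(x_k)\times\{t_k-\varepsilon^2\}|}+\frac\alpha2\delta_{(x_k+\varepsilon\sigma,t_k-\varepsilon^2)}(A)+\frac\alpha2\delta_{(x_k-\varepsilon\sigma,t_k-\varepsilon^2)}(A),$$ where $|\cdot|$ is $n$-dimensional Lebesgue measure and $\delta$ denotes the Dirac measure. The game stops at the first time $\tau$ with $(x_\tau,t_\tau)\in\Gamma_\varepsilon$. With $\mathbb{E}_S^{(x_0,t_0)}$ the expectation for the resulting probability measure on game sequences (Kolmogorov extension), the value of the game is $u^\varepsilon(x_0,t_0)=\sup_S\mathbb{E}_S^{(x_0,t_0)}[F(x_\tau,t_\tau)]$. *)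

(* Defs.v *)
From HB Require Import structures.
From mathcomp Require Import all_boot all_order all_algebra.
From mathcomp Require Import all_classical all_reals all_analysis.

Set Implicit Arguments.
Unset Strict Implicit.
Unset Printing Implicit Defensive.

Import Order.TTheory GRing.Theory Num.Theory.
Import numFieldNormedType.Exports.

Local Open Scope classical_set_scope.
Local Open Scope ring_scope.

Section borel_rV.
Context {R : realType} {n : nat}.

Definition borel_rV : set (set 'rV[R]_n) := <<s @open 'rV[R]_n >>.

Let borel_rV0 : borel_rV set0. Proof. exact: sigma_algebra0. Qed.

Let borel_rVC A : borel_rV A -> borel_rV (~` A).
Proof. exact: sigma_algebraC. Qed.

Let borel_rV_bigcup (A : (set 'rV[R]_n)^nat) :
  (forall i, borel_rV (A i)) -> borel_rV (\bigcup_i A i).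
Proof. exact: sigma_algebra_bigcup. Qed.

HB.instance Definition _ := @isMeasurable.Build (sigma_display (@open 'rV[R]_n))
  'rV[R]_n borel_rV borel_rV0 borel_rVC borel_rV_bigcup.

End borel_rV.

Section tuple_lebesgue.
Context {R : realType}.

Definition cons_tuple n (z : measurableTypeR R * n.-tuple (measurableTypeR R)) :
  n.+1.-tuple (measurableTypeR R) := [tuple of z.1 :: z.2].

Lemma measurable_cons_tuple n : measurable_fun [set: _] (@cons_tuple n).
Proof. exact: measurable_cons. Qed.

Section cons_measure.
Variables (n : nat)
  (m : {sigma_finite_measure set (n.-tuple (measurableTypeR R)) -> \bar R}).

Definition cons_lebesgue : set (n.+1.-tuple (measurableTypeR R)) -> \bar R :=
  pushforward ((@lebesgue_measure R) \x m)%E (@cons_tuple n).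

Let cons_lebesgue_measure :=
  measure_function_pushforward__canonical__measure_function_Measure
    ((@lebesgue_measure R) \x m)%E (@measurable_cons_tuple n).

HB.instance Definition _ := isMeasure.Build _ _ _ cons_lebesgue
  (measure0 cons_lebesgue_measure) (measure_ge0 cons_lebesgue_measure)
  (@measure_semi_sigma_additive _ _ _ cons_lebesgue_measure).

Let cons_lebesgue_sigma_finite : sigma_finite setT cons_lebesgue.
Proof.
have /sigma_finiteP[A [AT ndA Aoo]] := sigma_finiteT (@lebesgue_measure R).
have /sigma_finiteP[B [BT ndB Boo]] := sigma_finiteT m.
pose f (v : n.+1.-tuple (measurableTypeR R)) :
  measurableTypeR R * n.-tuple (measurableTypeR R) :=
  (thead v, [tuple of behead v]).
have mf : measurable_fun setT f.
  apply: measurable_fun_pair; first exact: measurable_tnth.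
  exact: measurable_behead.
have fK z : f (cons_tuple z) = z.
  by case: z => a v; congr pair; apply/val_inj.
exists (fun k => f @^-1` (A k `*` B k)).
  rewrite -preimage_bigcup -(@preimage_setT _ _ f); congr (_ @^-1` _).
  rewrite -setXTT AT BT; apply/seteqP; split=> -[x y]; last first.
    by move=> [k _ []/= ? ?]; split; exists k.
  move=> [/= [k _ Akx] [l _ Bly]]; exists (maxn k l) => //; split.
    by move: x Akx; exact/subsetPset/ndA/leq_maxl.
  by move: y Bly; exact/subsetPset/ndB/leq_maxr.
move=> k; have [mA Ak] := Aoo k; have [mB Bk] := Boo k; split.
  by rewrite -[X in measurable X]setTI; apply: mf => //; exact: measurableX.
rewrite /cons_lebesgue /pushforward -comp_preimage.
rewrite (_ : f \o _ = id); last by apply/funext => z; exact: fK.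
by rewrite preimage_id product_measure1E// lte_mul_pinfty// ge0_fin_numE.
Qed.

HB.instance Definition _ := Measure_isSigmaFinite.Build _ _ _ cons_lebesgue
  cons_lebesgue_sigma_finite.

End cons_measure.

Fixpoint tuple_lebesgue n :
    {sigma_finite_measure set (n.-tuple (measurableTypeR R)) -> \bar R} :=
  if n is n'.+1 then cons_lebesgue (tuple_lebesgue n') else \d_[tuple].

End tuple_lebesgue.

Section lebesgue_rV.
Context {R : realType}.

Definition row_of_tuple n (v : n.-tuple (measurableTypeR R)) : 'rV[R]_n :=
  \row_i tnth v i.

Lemma measurable_row_of_tuple n : measurable_fun [set: _] (@row_of_tuple n).
Proof.
apply: (@measurability _ _ _ _ _ _ (@open 'rV[R]_n)) => //.
move=> _ [U oU <-]; rewrite setTI.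
pose c (q : 'rV[rat]_n) : 'rV[R]_n := map_mx ratr q.
pose D := [set q : 'rV[rat]_n * rat | ball (c q.1) (ratr q.2) `<=` U].
have -> : U = \bigcup_(q in D) ball (c q.1) (ratr q.2).
  apply/seteqP; split=> [v Uv|v [q Dq qv]]; last exact: Dq.
  have [e /= e0 veU] := (nbhs_ballP _ _).1 (open_nbhs_nbhs (conj oU Uv)).
  have [r r0e] : exists r : rat, (ratr r : R) \in `]0, e / 2[.
    by apply: rat_in_itvoo; rewrite divr_gt0.
  have /andP[r0 re] : 0 < (ratr r : R) < e / 2 by move: r0e; rewrite in_itv.
  have /choice[q qv] : forall i : 'I_n, exists q : rat,
      (ratr q : R) \in `]v ord0 i - ratr r, v ord0 i + ratr r[.
    by move=> i; apply: rat_in_itvoo; rewrite ltrBlDr -addrA ltrDl addr_gt0.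
  have cv : ball (c (\row_i q i)) (ratr r) v.
    split=> // i j; rewrite ord1 !mxE /ball /= ltr_distlC.
    move: (qv j); rewrite in_itv /= ltrBlDr => /andP[h1 h2].
    by rewrite ltrBlDr h2 h1.
  exists (\row_i q i, r) => //= w cw; apply: veU.
  apply: (@le_ball _ _ v (ratr r + ratr r)).
    by rewrite [leRHS]splitr lerD// ltW.
  by apply: ball_triangle cw; exact: ball_sym.
rewrite preimage_bigcup bigcup_mkcond.
apply: countable_bigcupT_measurable => // -[q r].
case: ifP => // _ /=.
have [r0|r0] := ltP 0 (ratr r : R); last first.
  rewrite (_ : _ @^-1` _ = set0)//; apply/seteqP; split=> // v [].
  by rewrite ltNge r0.
rewrite (_ : _ @^-1` _ = \bigcap_(i : 'I_n)
    ((fun v => tnth v i) @^-1` ball (ratr (q ord0 i) : R) (ratr r))).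
  apply: fin_bigcap_measurable => // i _.
  rewrite -[X in measurable X]setTI.
  apply: measurable_tnth => //; rewrite ball_itv; exact: measurable_itv.
apply/seteqP; split=> v /=.
  by move=> [_ qv] i _ /=; have := qv ord0 i; rewrite !mxE.
by move=> qv; split=> // i j; rewrite ord1 !mxE; exact: qv.
Qed.

Definition lebesgue_rV n : set 'rV[R]_n -> \bar R :=
  pushforward (@tuple_lebesgue R n) (@row_of_tuple n).

Let lebesgue_rV_measure n :=
  measure_function_pushforward__canonical__measure_function_Measure
    (@tuple_lebesgue R n) (@measurable_row_of_tuple n).

HB.instance Definition _ n := isMeasure.Build _ _ _ (@lebesgue_rV n)
  (measure0 (lebesgue_rV_measure n)) (measure_ge0 (lebesgue_rV_measure n))
  (@measure_semi_sigma_additive _ _ _ (lebesgue_rV_measure n)).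

End lebesgue_rV.

Section lebesgue_rV_box.
Context {R : realType}.

Lemma lebesgue_rV_box n (A : 'I_n -> set R) : (forall i, measurable (A i)) ->
  @lebesgue_rV R n [set v | forall i, A i (v ord0 i)] =
  (\prod_(i < n) @lebesgue_measure R (A i))%E.
Proof.
move=> mA; rewrite /lebesgue_rV /pushforward.
rewrite (_ : _ @^-1` _ =
    [set v : n.-tuple (measurableTypeR R) | forall i, A i (tnth v i)]); last first.
  by apply/seteqP; split=> v /= vA i; have := vA i; rewrite mxE.
elim: n A mA => [|n IH] A mA /=.
  rewrite big_ord0 /= diracE (_ : _ \in _ = true)//.
  by apply/mem_set => -[].
rewrite /= /cons_lebesgue /pushforward big_ord_recl -IH//.
pose B : set (n.-tuple (measurableTypeR R)) :=
  [set v | forall i, A (lift ord0 i) (tnth v i)].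
rewrite (_ : _ @^-1` _ = A ord0 `*` B); last first.
  apply/seteqP; split=> -[x v] /=.
    move=> h; split; first exact: h ord0.
    by move=> i; have := h (lift ord0 i); rewrite tnthS.
  by move=> [xA vB] i; have [j ->|->//] := unliftP ord0 i; rewrite tnthS; exact: vB.
have mB : measurable B.
  rewrite (_ : B = \bigcap_(i : 'I_n)
      ((fun v => tnth v i) @^-1` A (lift ord0 i))); last first.
    by apply/seteqP; split=> v vB i; [move=> _|]; apply: vB.
  apply: fin_bigcap_measurable => // i _.
  rewrite -[X in measurable X]setTI.
  by apply: (@measurable_tnth _ (measurableTypeR R)) => //; exact: mA.
rewrite product_measure1E//; exact: mA.
Qed.

End lebesgue_rV_box.

Section euclidean.
Context {R : realType} {n : nat}.
Implicit Types (x y v : 'rV[R]_n) (A : set 'rV[R]_n).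

(* The norm of the library on ['rV_n] is the max norm. *)
Definition enorm v : R := Num.sqrt (\sum_i v ord0 i ^+ 2).

Definition eball x (r : R) : set 'rV[R]_n := [set y | enorm (y - x) < r].

Definition edist x A : R := inf [set enorm (x - y) | y in A].

Definition boundary A : set 'rV[R]_n := closure A `\` interior A.

Definition bounded_domain A : Prop :=
  [/\ open A, connected A, A !=set0 & bounded_set A].

Definition exterior_sphere A : Prop :=
  exists2 delta : R, 0 < delta &
    forall y, boundary A y -> exists z,
      eball z delta `<=` ~` A /\
      closure (eball z delta) `&` closure A = [set y].

End euclidean.

Section parabolic_sets.
Context {R : realType} {n : nat}.
Variables (Omega : set 'rV[R]_n) (T eps : R).

Definition cylinder : set ('rV[R]_n * R) := Omega `*` `]0, T[.

Definition outer_strip : set 'rV[R]_n :=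
  [set x | ~ Omega x /\ edist x (boundary Omega) <= eps].

Definition parabolic_strip : set ('rV[R]_n * R) :=
  outer_strip `*` `[- eps ^+ 2, T] `|` Omega `*` `[- eps ^+ 2, 0].

End parabolic_sets.

Definition alpha {R : realType} (n : nat) (p : R) : R := (p - 2) / (p + n%:R).

Definition beta {R : realType} (n : nat) (p : R) : R := (n%:R + 2) / (p + n%:R).

Section dynamic_programming.
Context {R : realType} {n : nat}.
Variables (Omega : set 'rV[R]_n) (p T eps : R).
Implicit Types (u F : 'rV[R]_n * R -> R).

Definition ball_average (f : 'rV[R]_n -> R) (x : 'rV[R]_n) : R :=
  (fine (lebesgue_rV (eball x eps)))^-1 *
  \int[@lebesgue_rV R n]_(y in eball x eps) f y.

Definition dpp u (x : 'rV[R]_n) (t : R) : Prop :=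
  u (x, t) =
    beta n p * ball_average (fun y => u (y, t - eps ^+ 2)) x +
    alpha n p * sup [set (u (x + eps *: s, t - eps ^+ 2) +
                      u (x - eps *: s, t - eps ^+ 2)) / 2
                | s in [set s | enorm s = 1]].

(* [u] and [F] are total; only their values on
   [cylinder `|` parabolic_strip], resp. [parabolic_strip], are relevant. *)
Definition dpp_solution F u : Prop :=
  [/\ measurable_fun (cylinder Omega T `|` parabolic_strip Omega T eps) u,
      forall z, parabolic_strip Omega T eps z -> u z = F z &
      forall x t, cylinder Omega T (x, t) -> dpp u x t].

End dynamic_programming.

Section game.
Context {R : realType} {n : nat}.
Variables (Omega : set 'rV[R]_n) (p T eps : R).

(* Product sigma-algebra on the space of sequences of token positions. *)
Definition coordinate_sets : set (set (nat -> 'rV[R]_n)) :=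
  [set C | exists k, exists2 A : set 'rV[R]_n,
     measurable A & C = [set w | A (w k)]].

Definition plays := g_sigma_algebraType coordinate_sets.

Definition history (w : plays) (k : nat) : k.+1.-tuple 'rV[R]_n :=
  [tuple w i | i < k.+1].

Definition strategy := forall k : nat, R * k.+1.-tuple 'rV[R]_n -> 'rV[R]_n.

Definition borel_strategy (S : strategy) : Prop :=
  forall k, measurable_fun setT (S k) /\ forall h, enorm (S k h) = 1.

Definition game_time (t0 : R) (k : nat) : R := t0 - k%:R * eps ^+ 2.

Definition step_law (x s : 'rV[R]_n) (A : set 'rV[R]_n) : \bar R :=
  ((beta n p)%:E * (lebesgue_rV (A `&` eball x eps) *
                     ((fine (lebesgue_rV (eball x eps)))^-1)%:E) +
   (alpha n p / 2)%:E * \d_(x + eps *: s)%R A +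
   (alpha n p / 2)%:E * \d_(x - eps *: s)%R A)%E.

(* The law of the position [k.+1] given the positions [0], ..., [k]. Once the
   game is over, which is when the token has left the cylinder, the token no
   longer moves. *)
Definition transition (S : strategy) (t0 : R) (k : nat)
    (h : k.+1.-tuple 'rV[R]_n) : set 'rV[R]_n -> \bar R :=
  let x := tnth h ord_max in
  if (x, game_time t0 k) \in cylinder Omega T
  then step_law x (S k (t0, h)) else \d_x.

(* [P] is the law of the game under [S]: these conditions determine the
   finite-dimensional distributions of [P], hence [P] itself. *)
Definition game_law (S : strategy) (x0 : 'rV[R]_n) (t0 : R)
    (P : probability plays R) : Prop :=
  P [set w | w 0%N = x0] = 1%E /\
  forall k (A : set (k.+1.-tuple 'rV[R]_n)) (B : set 'rV[R]_n),
    measurable A -> measurable B ->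
    P [set w | A (history w k) /\ B (w k.+1)] =
    (\int[P]_(w in [set w | A (history w k)])
       transition S t0 (history w k) B)%E.

Definition in_strip (t0 : R) (w : plays) (k : nat) : bool :=
  `[< parabolic_strip Omega T eps (w k, game_time t0 k) >].

Definition stopping_time (t0 : R) (w : plays) : option nat :=
  if pselect (exists k, in_strip t0 w k) is left ex then Some (ex_minn ex)
  else None.

(* The default value is irrelevant: the game stops almost surely. *)
Definition payoff (F : 'rV[R]_n * R -> R) (t0 : R) (w : plays) : R :=
  if stopping_time t0 w is Some k then F (w k, game_time t0 k) else 0.

Definition game_value (F : 'rV[R]_n * R -> R) (x0 : 'rV[R]_n) (t0 : R)
    : \bar R :=
  ereal_sup [set e | exists (S : strategy) (P : probability plays R),
    [/\ borel_strategy S, game_law S x0 t0 P & e = 'E_P[payoff F t0]%E]].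

End game.

(* Main.v *)
Require Import Defs.
From mathcomp Require Import all_boot all_order all_algebra.
From mathcomp Require Import all_classical all_reals all_analysis.
From mathcomp Require Import measurable_realfun borel_hierarchy.
From mathcomp Require Import ring lra.
Set Implicit Arguments.
Unset Strict Implicit.
Unset Printing Implicit Defensive.
Import Order.TTheory GRing.Theory Num.Theory.
Import numFieldNormedType.Exports.
Local Open Scope classical_set_scope.
Local Open Scope ring_scope.

(** The value function of the game solves the dynamic programming principle
    because, along a play, the value of [u] at the position of the token,
    stopped when the token leaves the cylinder, is a supermartingale under every
    strategy and, up to an arbitrarily small error per step, a submartingale
    under a good one. Time decreases by [eps ^+ 2] at each step, so every play
    stops within a number of steps that depends only on the starting time.
    Hence the expected payoff is at most [u (x, t)] for every strategy
    ([expected_payoff_le]) and at least [u (x, t)] minus an arbitrary error for a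
    suitable one ([expected_payoff_ge]).

    The obstacle is measurability: a strategy has to be Borel, and a supremum
    over directions of a Borel function need neither be Borel nor have Borel
    near-maximisers. The remedy is a smaller class of functions. Say that a
    time slice of [u] is regular if it is bounded and all its superlevel sets
    are F_sigma. The initial slices are regular since [F] is continuous on a
    compact set. The right-hand side of the principle preserves regularity:
    ball averages are lower semicontinuous, and the set where the two-point
    supremum exceeds a level is a countable union of projections, along the
    compact sphere, of closed sets ([two_point_sup_Fsigma]). So all slices are
    regular, by induction on time ([regular_slice_all]). In the same way, the
    directions that beat a given level at [x] form a countable union of
    compact sets depending measurably on [x], from each of which a Borel
    selector can be extracted ([measurable_selection]); choosing among the
    countably many selectors gives a near-optimal Borel strategy
    ([measurable_near_optimal]).

    The random displacement of the token is encoded by one noise variable: a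
    law on pairs (vector, scalar) such that, if (v, a) is drawn from it, then
    [x + v + a *: s] has the law of the step from [x] in direction [s]
    ([noise_law_exists]). Both halves of the probabilistic part then reduce to
    Fubini's theorem for the product of the law of the play with the law of
    the noise: the conditional expectation of a function of the next position
    ([one_step]), and the construction of a law of the game for a given
    strategy by appending one random position at a time ([game_law_exists]).
    Finitely many steps suffice for the latter, because the token is at rest
    once time has become nonpositive. *)

(** * F_sigma sets *)

Section Fsigma_theory.
Context {T : topologicalType}.

Lemma Fsigma_countable_bigcup (I : countType) (S : I -> set T) :
  (forall i, Fsigma (S i)) -> Fsigma (\bigcup_i S i).
Proof.
move=> /(_ _)/cid2 FS.
pose G (k : nat) : set T := if @unpickle (I * nat)%type k is Some (i, j)
  then s2val (FS i) j else set0.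
exists G => [k|].
  rewrite /G; case: unpickle => [[i j]|]; last exact: closed0.
  by case: (FS i) => /= H.
apply/seteqP; split=> x [].
  move=> i _; have := s2valP' (FS i) => /= E.
  rewrite E => -[j _ Hx]; exists (pickle (i, j)) => //.
  by rewrite /G pickleK.
move=> k _; rewrite /G; case: unpickle => // -[i j] Hx.
exists i => //; rewrite (s2valP' (FS i)); by exists j.
Qed.

Lemma Fsigma0 : Fsigma (@set0 T).
Proof. exact/closed_Fsigma/closed0. Qed.

Lemma FsigmaU (A B : set T) : Fsigma A -> Fsigma B -> Fsigma (A `|` B).
Proof.
move=> FA FB; rewrite -bigcup2E.
apply: Fsigma_countable_bigcup; rewrite /bigcup2 => -[|[|k]] //=; exact: Fsigma0.
Qed.

Lemma FsigmaI (A B : set T) : Fsigma A -> Fsigma B -> Fsigma (A `&` B).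
Proof.
move=> [F cF ->] [G cG ->].
rewrite setI_bigcupl; apply: Fsigma_countable_bigcup => i.
rewrite setI_bigcupr; apply: Fsigma_countable_bigcup => j.
by apply: closed_Fsigma; apply: closedI.
Qed.

End Fsigma_theory.

Lemma open_Fsigma {R : realType} {V : pseudoMetricNormedZmodType R} (U : set V) :
  open U -> Fsigma U.
Proof.
move=> oU; exists (fun k => [set x | ball x k.+1%:R^-1 `<=` U]) => [k|].
  rewrite -openC openE => x /existsNP[y /not_implyP[xy Uy]].
  apply: (@filterS _ _ _ (ball y k.+1%:R^-1)).
    by move=> z yz zU; apply: Uy; apply: zU; exact: ball_sym.
  by apply: open_nbhs_nbhs; split; [exact: ball_open|exact: ball_sym].
apply/seteqP; split=> x.
  move=> Ux; have [e /= e0 xe] := (nbhs_ballP _ _).1 (open_nbhs_nbhs (conj oU Ux)).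
  have [k _ /(_ k (leqnn k)) /= ke] := near_infty_natSinv_lt (PosNum e0).
  by exists k => //; apply: subset_trans xe; exact/le_ball/ltW.
by move=> [k _]; apply; exact: ballxx.
Qed.

(** Compactness of [K] lets a neighbourhood of [x] be chosen uniformly in the
    points of [K]. *)
Lemma closed_projection {T U : topologicalType} (K : set U) (C : set (T * U)) :
  compact K -> closed C -> closed [set x | exists2 y, K y & C (x, y)].
Proof.
move=> /compact_near_coveringP cK cC.
rewrite -openC openE => x xNC.
have : \near x, K `<=` (fun y => ~ C (x, y)).
  apply: cK => y Ky.
  have /nbhs_interior : nbhs (x, y) (~` C).
    apply: open_nbhs_nbhs; split; first exact: closed_openC.
    by move=> Cxy; apply: xNC; exists y.
  move=> /nbhs_singleton [[A B] [/= nA nB] AB].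
  by exists (B, A) => // -[b a] [/= ? ?]; apply: (AB (a, b)).
by apply: filterS => z zK [y /zK].
Qed.

(** * Measurability of vector-valued maps *)
Lemma measurable_fun_superlevel {R : realType} d (X : measurableType d)
    (D : set X) (f : X -> R) :
  (forall c, measurable (D `&` [set x | c < f x])) -> measurable_fun D f.
Proof.
move=> mf mD; apply: (measurability _ (RGenOInfty.measurableE R)) => //.
move=> _ [_ [a ->] <-].
rewrite (_ : _ @^-1` _ = [set x | a < f x]) ?mf//.
by apply/seteqP; split=> x /=; rewrite in_itv/= andbT.
Qed.

Lemma measurable_fun_sublevel {R : realType} d (X : measurableType d)
    (D : set X) (f : X -> R) :
  (forall c, measurable (D `&` [set x | f x < c])) -> measurable_fun D f.
Proof.
move=> mf mD; apply: (measurability _ (RGenInftyO.measurableE R)) => //.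
move=> _ [_ [a ->] <-].
by rewrite (_ : _ @^-1` _ = [set x | f x < a]) ?mf.
Qed.

Section measurable_rV.
Context {R : realType} {n : nat}.
Implicit Types A : set 'rV[R]_n.

Lemma open_measurable_rV A : open A -> measurable A.
Proof. exact: sub_sigma_algebra. Qed.

Lemma closed_measurable_rV A : closed A -> measurable A.
Proof.
move=> cA; rewrite -(setCK A); apply: measurableC; apply: open_measurable_rV.
exact: closed_openC.
Qed.

Lemma Fsigma_measurable_rV A : Fsigma A -> measurable A.
Proof.
by move=> [F cF ->]; apply: bigcupT_measurable => k; apply: closed_measurable_rV.
Qed.

Lemma continuous_measurable_rV (f : 'rV[R]_n -> R) :
  continuous f -> measurable_fun setT f.
Proof.
move=> cf; apply: measurable_fun_superlevel => c; rewrite setTI.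
apply: open_measurable_rV.
have og : open [set r : R | c < r] by exact: open_gt.
by apply: (open_comp _ og) => x _; exact: cf.
Qed.

Lemma measurable_coord_rV (i : 'I_n) :
  measurable_fun setT (fun x : 'rV[R]_n => x ord0 i).
Proof. by apply: continuous_measurable_rV; exact: coord_continuous. Qed.

Context {d} {X : measurableType d}.
Implicit Types f g : X -> 'rV[R]_n.

(** The Borel sets of ['rV_n] are not generated by the coordinates by
    definition; that they are in effect is the content of
    [measurable_row_of_tuple], through which the map is factored. *)
Lemma measurable_fun_rV f :
  (forall i, measurable_fun setT (fun x => f x ord0 i)) -> measurable_fun setT f.
Proof.
move=> mf.
pose h x : n.-tuple (measurableTypeR R) := [tuple f x ord0 i | i < n].
rewrite (_ : f = @row_of_tuple R n \o h).
  apply: measurableT_comp; first exact: measurable_row_of_tuple.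
  apply/measurable_fun_tnthP => i.
  rewrite (_ : _ \o h = (fun x => f x ord0 i)); first exact: mf.
  by apply/funext => x /=; rewrite tnth_mktuple.
by apply/funext => x; apply/rowP => i; rewrite mxE tnth_mktuple.
Qed.

Lemma measurable_coord_comp f i :
  measurable_fun setT f -> measurable_fun setT (fun x => f x ord0 i).
Proof. by move=> mf; apply: (measurableT_comp (measurable_coord_rV i) mf). Qed.

Lemma measurable_funD_rV f g : measurable_fun setT f -> measurable_fun setT g ->
  measurable_fun setT (fun x => f x + g x).
Proof.
move=> mf mg; apply: measurable_fun_rV => i.
under eq_fun do rewrite mxE.
by apply: measurable_funD; apply: measurable_coord_comp.
Qed.

Lemma measurable_funZ_rV (a : X -> R) f : measurable_fun setT a ->
  measurable_fun setT f -> measurable_fun setT (fun x => a x *: f x).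
Proof.
move=> ma mf; apply: measurable_fun_rV => i.
under eq_fun do rewrite mxE.
by apply: measurable_funM => //; apply: measurable_coord_comp.
Qed.

End measurable_rV.

(** * Measurable selection *)
Section countable_gluing.
Context {d d'} {X : measurableType d} {Y : measurableType d'}.

(** The first index [k] with [dom k x] partitions the space into countably many
    measurable pieces. *)
Lemma measurable_glue (dom : nat -> set X) (s : nat -> X -> Y) (y0 : Y) (f : X -> Y) :
  (forall k, measurable (dom k)) ->
  (forall k, measurable_fun (dom k) (s k)) ->
  (forall k x, dom k x -> (forall j, (j < k)%N -> ~ dom j x) -> f x = s k x) ->
  (forall x, (forall k, ~ dom k x) -> f x = y0) ->
  measurable_fun setT f.
Proof.
move=> mdom ms fs f0.
pose E k := dom k `\` \bigcup_(j in `I_k) dom j.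
have mE k : measurable (E k).
  by apply: measurableD => //; apply: bigcup_measurable.
rewrite -(setvU (\bigcup_k E k)); apply/measurable_funU.
- exact/measurableC/bigcupT_measurable.
- exact: bigcupT_measurable.
split; last first.
  apply/measurable_fun_bigcup => // k.
  apply: (@eq_measurable_fun _ _ _ _ _ (s k)); last first.
    by apply: measurable_funS (ms k) => // x [].
  move=> x /set_mem[dx nx]; rewrite (fs k)// => j jk djx; apply: nx.
  by exists j.
apply: (@eq_measurable_fun _ _ _ _ _ (cst y0)) => // x /set_mem nE.
rewrite f0// => k dk; apply: nE.
have ex : exists k, `[< dom k x >] by exists k; exact/asboolP.
have [m /asboolP dm mmin] := ex_minnP ex.
exists m => //; split=> // -[j /= jm djx].
by have /mmin := asboolT djx; rewrite leqNgt jm.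
Qed.

Lemma measurable_countable_choice (I : countType) (dom : I -> set X)
    (s : I -> X -> Y) (y0 : Y) :
  (forall i, measurable (dom i)) -> (forall i, measurable_fun setT (s i)) ->
  exists2 f : X -> Y, measurable_fun setT f &
    forall x, f x = y0 /\ (forall i, ~ dom i x) \/
              exists2 i, dom i x & f x = s i x.
Proof.
move=> mdom ms.
pose dom' k := if @unpickle I k is Some i then dom i else set0.
pose s' k := if @unpickle I k is Some i then s i else cst y0.
pose f x := if pselect (exists k, `[< dom' k x >]) is left ex
  then s' (ex_minn ex) x else y0.
exists f.
  apply: (@measurable_glue dom' s' y0).
  - by move=> k; rewrite /dom'; case: unpickle.
  - move=> k; apply: (@measurable_funS _ _ _ _ setT) => //.
    by rewrite /s'; case: unpickle.
  - move=> k x dk nk; rewrite /f; case: pselect => [ex|[]]; last first.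
      by exists k; exact/asboolP.
    case: ex_minnP => m /asboolP dm mmin.
    have -> // : m = k.
    apply/eqP; rewrite eqn_leq mmin ?andTb; last exact/asboolP.
    by rewrite leqNgt; apply/negP => /nk.
  - move=> x nx; rewrite /f; case: pselect => // ex; exfalso.
    by have [k /asboolP /nx] := ex.
move=> x; rewrite /f; case: pselect => [ex|nex]; last first.
  left; split=> // i dx; apply: nex; exists (pickle i).
  by apply/asboolP; rewrite /dom' pickleK.
right; case: ex_minnP => m /asboolP + _; rewrite /dom' /s'.
by case: unpickle => // i dx; exists i.
Qed.

End countable_gluing.

Section selection.
Context {R : realType} {n : nat} {d} {X : measurableType d}.
Implicit Types (K : X -> set 'rV[R]_n) (C : set 'rV[R]_n).

(** Measurability of a set-valued map, tested on closed sets. *)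
Definition weakly_measurable K :=
  forall C, closed C -> measurable [set x | K x `&` C !=set0].

(** An enumeration of the pairs of closed half-spaces cut out by the rational
    values of the coordinates; the boolean says on which side to stay. Any two
    distinct points are separated by one of these pairs. Numbers that encode no
    pair impose no condition. *)
Definition cut (k : nat) (b : bool) : set 'rV[R]_n :=
  if @unpickle ('I_n * rat)%type k is Some (i, q)
  then [set v | if b then v ord0 i <= ratr q else ratr q <= v ord0 i]
  else setT.

Lemma cutE i q b v : cut (pickle (i, q)) b v =
  (if b then v ord0 i <= ratr q else ratr q <= v ord0 i) :> Prop.
Proof. by rewrite /cut pickleK; case: b. Qed.

Lemma closed_cut k b : closed (cut k b).
Proof.
rewrite /cut; case: unpickle => [[i q]|]; last exact: closedT.
have cc : continuous (fun v : 'rV[R]_n => v ord0 i) by exact: coord_continuous.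
by case: b; [have := @closed_le R (ratr q)|have := @closed_ge R (ratr q)] => cl;
  apply: (preimage_closed _ cl) => x _; exact: cc.
Qed.

Lemma cutT k v : cut k true v \/ cut k false v.
Proof.
rewrite /cut; case: unpickle => [[i q]|]; last by left.
by have [|/ltW] /= := leP (v ord0 i) (ratr q); [left|right].
Qed.

(** At each stage the set is cut by the next half-space, the left side being
    taken whenever it leaves a nonempty set. *)
Fixpoint refine K (k : nat) (x : X) : set 'rV[R]_n :=
  if k is k'.+1 then
    refine K k' x `&` cut k' `[< refine K k' x `&` cut k' true !=set0 >]
  else K x.

Lemma refine_neq0 K k x : K x !=set0 -> refine K k x !=set0.
Proof.
move=> Kx; elim: k => //= k [v Dv].
have [//|h] := asboolP (refine K k x `&` cut k true !=set0).
exists v; split=> //; have [cv|//] := cutT k v.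
by case: h; exists v.
Qed.

Lemma refine_subset K x j k : (j <= k)%N -> refine K k x `<=` refine K j x.
Proof.
elim: k => [|k IH]; first by rewrite leqn0 => /eqP ->.
rewrite leq_eqVlt => /predU1P[->//|]; rewrite ltnS => /IH jk.
by apply: subset_trans jk => v [].
Qed.

Lemma refine_compact K k x : compact (K x) -> compact (refine K k x).
Proof.
by move=> cK; elim: k => //= k IH; apply: compact_closedI => //; exact: closed_cut.
Qed.

(** Whether the left side is taken is itself an instance of the measurability
    of the previous stage, tested on a half-space. *)
Lemma weakly_measurable_refine K k :
  weakly_measurable K -> weakly_measurable (refine K k).
Proof.
move=> wK; elim: k => // k IH C cC.
pose L := [set x | refine K k x `&` cut k true !=set0].
have mL : measurable L by apply: IH; exact: closed_cut.
pose H b := [set x | refine K k x `&` (cut k b `&` C) !=set0].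
have mH b : measurable (H b) by apply: IH; apply: closedI => //; exact: closed_cut.
rewrite (_ : [set x | _] = (L `&` H true) `|` (~` L `&` H false)).
  apply: measurableU; apply: measurableI => //; exact: measurableC.
apply/seteqP; split=> x /=; rewrite ?setIA.
  have [Lx|Lx] := asboolP (refine K k x `&` cut k true !=set0) => h.
    by left; split=> //; rewrite /H /= setIA.
  by right; split=> //; rewrite /H /= setIA.
case=> -[Lx]; rewrite /H /= setIA.
  by rewrite asboolT.
by rewrite asboolF.
Qed.

(** The refined sets are nested nonempty compact sets. *)
Lemma refine_bigcap K x : compact (K x) -> K x !=set0 ->
  \bigcap_k refine K k x !=set0.
Proof.
move=> cK K0.
pose F := filter_from [set: nat] (fun k => refine K k x).
have PF : ProperFilter F.
  apply: filter_from_proper; last by move=> k _; exact: refine_neq0.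
  apply: filter_from_filter; first by exists 0%N.
  move=> i j _ _; exists (maxn i j) => // v Dv.
  by split; apply: refine_subset Dv; rewrite ?leq_maxl ?leq_maxr.
have [|v [Kv Fv]] := cK F PF; first by exists 0%N.
exists v => k _.
have /closure_id -> : closed (refine K k x).
  apply: compact_closed; first exact: norm_hausdorff.
  exact: refine_compact.
by move=> B nB; apply: Fv => //; exists k.
Qed.

(** A compact-valued form of the Kuratowski and Ryll-Nardzewski theorem. The
    selected point lies in all the refinements of [K x]; each of its
    coordinates is below [c] exactly when, for some rational [q < c], the cut at
    [q] went left, and this is a measurable condition on [x]. *)
Lemma measurable_selection K : (forall x, compact (K x)) ->
  weakly_measurable K ->
  exists2 s : X -> 'rV[R]_n, measurable_fun setT s &
    forall x, K x !=set0 -> K x (s x).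
Proof.
move=> cK wK.
pose s x := xget 0 (\bigcap_k refine K k x).
have sP x : K x !=set0 -> forall k, refine K k x (s x).
  move=> K0 k; have [v Dv] := refine_bigcap (cK x) K0.
  by have := @xgetPex _ 0 (\bigcap_k refine K k x); apply => //; exists v.
exists s; last by move=> x /sP /(_ 0%N).
pose dom := [set x | K x !=set0].
have mdom : measurable dom.
  rewrite (_ : dom = [set x | K x `&` setT !=set0]); first by apply: wK; exact: closedT.
  by under [in RHS]eq_set do rewrite setIT.
pose L k := [set x | refine K k x `&` cut k true !=set0].
have mL k : measurable (L k).
  by apply: (weakly_measurable_refine k wK); exact: closed_cut.
apply: measurable_fun_rV => i; apply: measurable_fun_sublevel => c.
rewrite setTI.
pose B := (\bigcup_(q in [set q : rat | ratr q < c]) L (pickle (i, q))).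
have sL x q : dom x -> if `[< L (pickle (i, q)) x >] then s x ord0 i <= ratr q
                       else ratr q <= s x ord0 i.
  move=> /sP /(_ (pickle (i, q)).+1) [_].
  by rewrite /= cutE.
rewrite (_ : [set x | _] =
    (~` dom `&` [set x | 0 < c]) `|` (dom `&` B)).
  apply: measurableU; apply: measurableI => //.
  - exact: measurableC.
  - have [c0|c0] := ltP 0 c.
      by rewrite (_ : [set x | _] = setT) //; apply/seteqP; split.
    by rewrite (_ : [set x | _] = set0) //; apply/seteqP; split.
  - rewrite /B bigcup_mkcond; apply: countable_bigcupT_measurable => // q.
    by case: ifP => // _; exact: mL.
apply/seteqP; split=> x /=.
  move=> sc; have [dx|dx] := pselect (dom x).
    right; split=> //.
    have [q] : exists q : rat, (ratr q : R) \in `]s x ord0 i, c[ by exact: rat_in_itvoo.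
    rewrite in_itv/= => /andP[sq qc].
    exists q => //; have := sL x q dx; case: asboolP => // _.
    by rewrite leNgt sq.
  left; split=> //; move: sc; rewrite /s /= xgetPN ?mxE// => v Dv.
  by apply: dx; exists v; exact: (Dv 0%N).
move=> [[dx c0]|[dx [q /= qc Lq]]].
  rewrite /s /= xgetPN ?mxE// => v Dv.
  by apply: dx; exists v; exact: (Dv 0%N).
have := sL x q dx; rewrite asboolT// => /le_lt_trans; exact.
Qed.

End selection.

(** * The Euclidean norm *)
Section enorm_theory.
Context {R : realType} {n : nat}.
Implicit Types (x y v : 'rV[R]_n) (r : R).

Lemma enorm_ge0 v : 0 <= enorm v.
Proof. exact: sqrtr_ge0. Qed.

Lemma enormZ (a : R) v : enorm (a *: v) = `|a| * enorm v.
Proof.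
rewrite /enorm -(sqrtr_sqr a) -sqrtrM ?sqr_ge0// mulr_sumr.
by congr Num.sqrt; apply: eq_bigr => i _; rewrite mxE exprMn.
Qed.

Lemma enorm0 : enorm (0 : 'rV[R]_n) = 0.
Proof. by rewrite -(scale0r 0) enormZ normr0 mul0r. Qed.

Lemma enormN v : enorm (- v) = enorm v.
Proof. by rewrite -scaleN1r enormZ normrN1 mul1r. Qed.

Lemma enormBC x y : enorm (x - y) = enorm (y - x).
Proof. by rewrite -enormN opprB. Qed.

Lemma coord_le_enorm v i : `|v ord0 i| <= enorm v.
Proof.
rewrite -sqrtr_sqr ler_wsqrtr// (bigD1 i)//= lerDl.
by apply: sumr_ge0 => j _; exact: sqr_ge0.
Qed.

Lemma norm_le_enorm v : `|v| <= enorm v.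
Proof.
rewrite /Num.norm/= mx_normrE; apply: bigmax_le => [|[i j] _ /=].
  exact: enorm_ge0.
by rewrite ord1; exact: coord_le_enorm.
Qed.

Lemma continuous_enorm : continuous (@enorm R n).
Proof.
have c2 : continuous (fun v : 'rV[R]_n => \sum_i v ord0 i ^+ 2).
  apply: continuous_big => [|i _ v]; first exact: add_continuous.
  apply: (@continuous_comp _ _ _ (fun v : 'rV[R]_n => v ord0 i) (fun r : R => r ^+ 2)).
    exact: coord_continuous.
  exact: exprn_continuous.
move=> v; apply: (@continuous_comp _ _ _ _ (@Num.sqrt R)); first exact: c2.
exact: sqrt_continuous.
Qed.

Lemma enormB_continuous x : continuous (fun y : 'rV[R]_n => enorm (y - x)).
Proof.
move=> y; apply: (@continuous_comp _ _ _ (fun y : 'rV[R]_n => y - x)).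
  by apply: (@continuousB R _ _ id (cst x)); [exact: cvg_id|exact: cst_continuous].
exact: continuous_enorm.
Qed.

Lemma open_eball x r : open (eball x r).
Proof.
have og : open [set z : R | z < r] by exact: open_lt.
by apply: (open_comp _ og) => y _; exact: enormB_continuous.
Qed.

Lemma measurable_eball x r : measurable (eball x r).
Proof. by apply: open_measurable_rV; exact: open_eball. Qed.

Lemma compact_sphere : compact [set s : 'rV[R]_n | enorm s = 1].
Proof.
apply: bounded_closed_compact.
  exists 1; split; first exact: num_real.
  by move=> a a1 v /= v1; rewrite (le_trans (norm_le_enorm v))// v1 ltW.
have cl : closed [set z : R | z = 1] by exact: closed_eq.
by apply: (preimage_closed _ cl) => y _; exact: continuous_enorm.
Qed.

Lemma enorm_delta (i : 'I_n) : enorm (delta_mx ord0 i : 'rV[R]_n) = 1.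
Proof.
rewrite /enorm (bigD1 i)//= big1 => [|j ji].
  by rewrite mxE !eqxx expr1n addr0 sqrtr1.
by rewrite mxE (negbTE ji) andbF expr0n.
Qed.

End enorm_theory.

(** * Lebesgue measure of balls and ball integrals *)
Section translation.
Context {R : realType} {n : nat}.
Implicit Types (a b x v : 'rV[R]_n).

Definition box a b : set 'rV[R]_n :=
  [set v | forall i, v ord0 i \in `]a ord0 i, b ord0 i[].

Definition boxes : set (set 'rV[R]_n) := [set A | exists a b, A = box a b].

Lemma boxes_setI : setI_closed boxes.
Proof.
move=> _ _ [a [b ->]] [a' [b' ->]].
exists (\row_i Num.max (a ord0 i) (a' ord0 i)),
  (\row_i Num.min (b ord0 i) (b' ord0 i)).
apply/seteqP; split=> v /=.
  move=> [h h'] i; have := h i; have := h' i.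
  by rewrite !in_itv/= !mxE gt_max lt_min => /andP[-> ->] /andP[-> ->].
move=> h; split=> i; have := h i;
by rewrite !in_itv/= !mxE gt_max lt_min => /andP[/andP[? ?] /andP[? ?]]; apply/andP.
Qed.

(** An open set is the union of the boxes with rational corners that it
    contains. *)
Lemma open_sigma_boxes (U : set 'rV[R]_n) : open U -> <<s boxes >> U.
Proof.
move=> oU.
pose c (q : 'rV[rat]_n) : 'rV[R]_n := map_mx ratr q.
have -> : U = \bigcup_(q : 'rV[rat]_n * 'rV[rat]_n)
    (if `[< box (c q.1) (c q.2) `<=` U >] then box (c q.1) (c q.2) else set0).
  apply/seteqP; split=> [v Uv|v [q _]]; last by case: asboolP => // + ?; exact.
  have [e /= e0 veU] := (nbhs_ballP _ _).1 (open_nbhs_nbhs (conj oU Uv)).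
  have /choice[q qv] : forall i : 'I_n, exists q : rat,
      (ratr q : R) \in `]v ord0 i - e, v ord0 i[.
    by move=> i; apply: rat_in_itvoo; rewrite ltrBlDr ltrDl.
  have /choice[r rv] : forall i : 'I_n, exists q : rat,
      (ratr q : R) \in `]v ord0 i, v ord0 i + e[.
    by move=> i; apply: rat_in_itvoo; rewrite ltrDl.
  exists (\row_i q i, \row_i r i) => //=.
  case: asboolP => [_|[]].
    move=> i; have := qv i; have := rv i; rewrite !in_itv/= !mxE.
    by move=> /andP[-> _] /andP[_ ->].
  move=> w cw; apply: veU; split=> // i j; rewrite ord1.
  have := cw j; have := qv j; have := rv j; rewrite !in_itv/= !mxE.
  move=> /andP[_ h1] /andP[h2 _] /andP[h3 h4].
  rewrite /ball /= distrC ltr_distl.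
  by rewrite (lt_trans h2 h3) (lt_trans h4 h1).
apply: (@countable_bigcupT_measurable _ (g_sigma_algebraType boxes)) => // q.
case: ifP => _; last exact: measurable0.
by apply: sub_sigma_algebra; eexists; eexists; reflexivity.
Qed.

Lemma measurable_box a b : measurable (box a b).
Proof.
rewrite (_ : box a b = \bigcap_(i : 'I_n) [set v : 'rV[R]_n | v ord0 i \in `]a ord0 i, b ord0 i[]).
  apply: fin_bigcap_measurable => // i _.
  have := @measurable_coord_rV R n i measurableT _ (measurable_itv `]a ord0 i, b ord0 i[).
  by rewrite setTI.
by apply/seteqP; split=> v vA i; [move=> _|]; apply: vA.
Qed.

Lemma lebesgue_box a b : lebesgue_rV (box a b) =
  (\prod_(i < n) Num.max 0 (b ord0 i - a ord0 i))%:E.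
Proof.
have := @lebesgue_rV_box R n (fun i => `]a ord0 i, b ord0 i[%classic)
  (fun i => measurable_itv _).
rewrite /box /= => ->; rewrite (big_morph EFin EFinM erefl).
apply: eq_bigr => i _; rewrite lebesgue_measure_itv/= lte_fin -subr_gt0.
by case: ltP.
Qed.

(** The measure and its translate agree on boxes, a generating family stable
    under intersection. *)
Lemma lebesgue_translation x (A : set 'rV[R]_n) : measurable A ->
  lebesgue_rV ((fun v => x + v) @^-1` A) = lebesgue_rV A.
Proof.
move=> mA.
have mx : measurable_fun setT (fun v : 'rV[R]_n => x + v).
  by apply: measurable_funD_rV; [exact: measurable_cst|exact: measurable_id].
pose m2 := measure_function_pushforward__canonical__measure_function_Measure
  (@lebesgue_rV R n) mx.
apply: (@g_sigma_algebra_measure_unique _ _ _ boxes _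
  (fun k => box (const_mx (- k.+1%:R)) (const_mx k.+1%:R)) _ _ m2 (@lebesgue_rV R n)).
- by move=> _ [a [b ->]]; exact: measurable_box.
- by move=> k; eexists; eexists; reflexivity.
- apply/seteqP; split=> // v _; exists (Num.truncn `|v|) => // i.
  have : `|v ord0 i| < (Num.truncn `|v|).+1%:R.
    apply: le_lt_trans (truncnS_gt _).
    rewrite {2}/Num.norm/= mx_normrE.
    exact: (@le_bigmax _ _ _ _ (fun j : 'I_1 * 'I_n => `|v j.1 j.2|) (ord0, i)).
  by rewrite ltr_norml in_itv/= !mxE.
- exact: boxes_setI.
- move=> _ [a [b ->]].
  rewrite /m2/= /pushforward (_ : _ @^-1` _ = box (a - x) (b - x)).
    rewrite !lebesgue_box; congr EFin; apply: eq_bigr => i _.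
    by rewrite !mxE opprB addrA subrK.
  apply/seteqP; split=> v /= h i; have := h i; rewrite !in_itv/= !mxE.
    by rewrite ltrBlDl ltrBrDl.
  by rewrite ltrBlDl ltrBrDl.
- move=> k /=; rewrite /pushforward.
  rewrite (_ : _ @^-1` _ = box (const_mx (- k.+1%:R) - x) (const_mx k.+1%:R - x)).
    by rewrite lebesgue_box ltry.
  apply/seteqP; split=> v /= h i; have := h i; rewrite !in_itv/= !mxE.
    by rewrite ltrBlDl ltrBrDl.
  by rewrite ltrBlDl ltrBrDl.
- move: mA; apply: smallest_sub; first exact: smallest_sigma_algebra.
  exact: open_sigma_boxes.
Qed.
End translation.

Lemma open_from_nbhs {T : topologicalType} (A : set T) :
  (forall x, A x -> nbhs x A) -> open A.
Proof. by move=> nA; rewrite openE. Qed.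

Section ball_integral.
Context {R : realType} {n : nat}.
Implicit Types (x v : 'rV[R]_n) (r : R).
Local Open Scope ereal_scope.

(** The ball contains the box of half-width [r / n.+1]. *)
Lemma lebesgue_eball_gt0 x r : (0 < r)%R -> 0 < lebesgue_rV (eball x r).
Proof.
move=> r0; pose d := (r / n.+1%:R)%R.
have d0 : (0 < d)%R by rewrite divr_gt0.
apply: (@lt_le_trans _ _ (lebesgue_rV (box (x - const_mx d) (x + const_mx d)))).
  rewrite lebesgue_box lte_fin; apply: prodr_gt0 => i _.
  by rewrite !mxE lt_max; apply/orP; right; lra.
apply: le_measure; rewrite ?inE.
- exact: measurable_box.
- exact: measurable_eball.
move=> v h; rewrite /eball/= /enorm -[ltRHS]gtr0_norm// -sqrtr_sqr ltr_sqrt ?exprn_gt0//.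
apply: (@le_lt_trans _ _ (\sum_(i < n) d ^+ 2)%R).
  apply: ler_sum => i _; have := h i; rewrite in_itv/= !mxE => /andP[h1 h2].
  rewrite -real_normK ?num_real// ler_sqr ?nnegrE// ?ltW//.
  by rewrite ltr_norml; apply/andP; split; lra.
(* n * (r / (n + 1)) ^ 2 < r ^ 2 *)
rewrite sumr_const card_ord /d expr_div_n -[ltLHS]mulr_natl mulrCA gtr_pMr ?exprn_gt0//.
rewrite ltr_pdivrMr ?exprn_gt0// mul1r -natrX ltr_nat.
exact: (@leq_pexp2l n.+1 1 2).
Qed.

Lemma lebesgue_eball_fin x r : lebesgue_rV (eball x r) < +oo.
Proof.
apply: (@le_lt_trans _ _ (lebesgue_rV (box (x - const_mx r) (x + const_mx r)))).
  apply: le_measure; rewrite ?inE.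
  - exact: measurable_eball.
  - exact: measurable_box.
  move=> v h i; rewrite in_itv/= !mxE.
  have := le_lt_trans (coord_le_enorm (v - x) i) h; rewrite !mxE ltr_norml.
  by rewrite ltrBlDl => /andP[]; rewrite ltrBrDl => -> ->.
by rewrite lebesgue_box ltry.
Qed.

Lemma eballE x v r : eball x r (x + v)%R = eball 0 r v.
Proof. by rewrite /eball/= addrAC subrr add0r subr0. Qed.

Lemma measurable_translation x : measurable_fun setT (fun v : 'rV[R]_n => x + v)%R.
Proof. by apply: measurable_funD_rV; [exact: measurable_cst|exact: measurable_id]. Qed.

Lemma lebesgue_eball_center x r : lebesgue_rV (eball x r) =
  @lebesgue_rV R n (eball 0 r).
Proof.
rewrite -(lebesgue_translation x (measurable_eball x r)).
by congr (@lebesgue_rV R n _); apply/funext => v; rewrite /preimage/= eballE.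
Qed.

Lemma integral_eball_center x r (f : 'rV[R]_n -> \bar R) :
  measurable_fun setT f -> (forall v, 0 <= f v) ->
  \int[@lebesgue_rV R n]_(y in eball x r) f y =
  \int[@lebesgue_rV R n]_(v in eball 0 r) f (x + v)%R.
Proof.
move=> mf f0.
have mx := measurable_translation x.
pose m2 := measure_function_pushforward__canonical__measure_function_Measure
  (@lebesgue_rV R n) mx.
transitivity (\int[m2]_(y in eball x r) f y).
  apply: eq_measure_integral => A mA _.
  by rewrite /m2/= /pushforward lebesgue_translation.
rewrite (ge0_integral_pushforward mx _ (measurable_eball x r) (measurable_funTS mf)).
  by rewrite (_ : _ @^-1` _ = eball 0 r)//; apply/funext => v; exact: eballE.
by move=> y _; exact: f0.
Qed.

(** Lower semicontinuity of ball integrals. If it failed at [x], some sequence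
    [z] would tend to [x] with integrals at most [c]; but the indicators of
    the balls around [z k] tend to 1 on the open ball around [x], and Fatou's
    lemma would bound the integral at [x] by [c] as well. *)
Lemma open_integral_eball r (h : 'rV[R]_n -> \bar R) (c : \bar R) :
  measurable_fun setT h -> (forall v, 0 <= h v) ->
  open [set x | c < \int[@lebesgue_rV R n]_(y in eball x r) h y].
Proof.
move=> mh h0; apply: open_from_nbhs => x /= cx.
apply: contrapT => nx.
have /choice[z zP] : forall k, exists z, ball x k.+1%:R^-1%R z /\
    \int[@lebesgue_rV R n]_(y in eball z r) h y <= c.
  move=> k; apply: contrapT => /forallNP H; apply: nx.
  have : nbhs x (ball x (k.+1%:R^-1 : R)%R) by apply: nbhsx_ballx; rewrite invr_gt0.
  apply: filterS => z xz /=; rewrite ltNge; apply/negP => hz.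
  by apply: (H z).
have zx : z k @[k --> \oo] --> x.
  apply/cvgrPdist_lt => e e0; near=> k.
  have [+ _] := zP k.
  rewrite -ball_normE /= => /lt_trans; apply.
  by near: k; exact: (near_infty_natSinv_lt (PosNum e0)).
move: cx; apply/negP; rewrite -leNgt.
pose f k y := (\1_(eball (z k) r) y)%:E * h y.
have mf k D : measurable_fun D (f k).
  apply: emeasurable_funM; last exact: measurable_funTS.
  by apply/measurable_EFinP; apply: measurable_indic; exact: measurable_eball.
have f0 k y : 0 <= f k y by rewrite mule_ge0// lee_fin.
have fle k : \int[@lebesgue_rV R n]_(y in eball x r) f k y <= c.
  have [_] := zP k; apply: le_trans.
  rewrite [leRHS]integral_mkcond.
  apply: (@le_trans _ _ (\int[@lebesgue_rV R n]_y f k y)).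
    by apply: ge0_subset_integral => //; exact: measurable_eball.
  rewrite le_eqVlt; apply/orP; left; apply/eqP; apply: eq_integral => y _.
  rewrite /f patchE indicE; case: ifP => _; by rewrite ?mul1e ?mul0e.
apply: (@le_trans _ _ (limn_einf (fun k => \int[@lebesgue_rV R n]_(y in eball x r) f k y))); last first.
  rewrite limn_einf_lim; apply: lime_le; first exact: is_cvg_einfs.
  apply: nearW => k; apply: le_trans (fle k); apply: ereal_inf_lbound.
  by exists k => //=.
apply: le_trans (fatou _ _ _ _) => //; last exact: measurable_eball.
rewrite le_eqVlt; apply/orP; left; apply/eqP; apply: eq_integral => y /set_mem yx.
have fy : f k y @[k --> \oo] --> h y.
  apply: cvg_near_cst; near=> k.
  rewrite /f indicE mem_set ?mul1e//.
  near: k.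
  have : (fun v : 'rV[R]_n => enorm (y - v)) v @[v --> x] --> enorm (y - x).
    under eq_fun do rewrite enormBC.
    by rewrite enormBC; exact: enormB_continuous.
  by move=> /(cvg_comp _ _ zx)/cvgr_lt; exact.
by rewrite (cvg_limn_einf_sup fy).1.
Unshelve. all: by end_near. Qed.

End ball_integral.

(** * Geometry of the domain and of the boundary strip *)
Section boundary_crossing.
Context {R : realType} {n : nat}.
Implicit Types (x y z v : 'rV[R]_n) (A : set 'rV[R]_n).

(** Without a boundary point on the segment from [x] to [y], the points of the
    segment in [A] would form a subset of it that is both relatively open and
    relatively closed. *)
Lemma boundary_crossing A x y : open A -> A x -> ~ A y ->
  exists2 z, boundary A z & enorm (y - z) <= enorm (y - x).
Proof.
move=> oA Ax Ay.
have cg : continuous (fun s : R => x + s *: (y - x)).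
  move=> s; apply: (@continuousD R _ _ (cst x) (fun s : R => s *: (y - x))).
    exact: cst_continuous.
  exact: scalel_continuous.
set g := (fun s : R => _) in cg.
apply: contrapT => /forall2NP nb.
have gA s : s \in `[0, 1] -> closure A (g s) -> A (g s).
  rewrite in_itv/= => /andP[s0 s1] cA; apply: contrapT => nA.
  have [[]|] := nb (g s); first by split => // /interior_subset.
  apply; rewrite (_ : y - g s = (1 - s) *: (y - x)).
    by rewrite enormZ ger0_norm ?subr_ge0// ler_piMl ?enorm_ge0// gerBl.
  by rewrite /g scalerBl scale1r opprD addrA.
have E : `[0%R, 1%R]%classic `&` g @^-1` A = `[0%R, 1%R]%classic.
  apply: (@segment_connected R 0 1).
  - by exists 0; split; rewrite /= ?in_itv/= ?lexx ?ler01// /g scale0r addr0.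
  - exists (g @^-1` A) => //; apply: (open_comp _ oA) => s _; exact: cg.
  - exists (g @^-1` closure A).
      by apply: (preimage_closed _ (@closed_closure _ A)) => s _; exact: cg.
    apply/seteqP; split=> s [/= s01 h]; split=> //; first exact: subset_closure.
    exact: gA.
have : (`[0%R, 1%R]%classic : set R) 1 by rewrite /= in_itv/= ler01 lexx.
rewrite -E => -[_] /=; rewrite /g scale1r addrC subrK; exact: Ay.
Qed.

End boundary_crossing.

Section arena.
Context {R : realType} {n : nat}.
Variables (Omega : set 'rV[R]_n) (T eps : R) (F : 'rV[R]_n * R -> R).
Hypotheses (n_gt0 : (0 < n)%N) (T_gt0 : 0 < T) (eps_gt0 : 0 < eps)
  (domO : bounded_domain Omega)
  (F_cont : {within parabolic_strip Omega T eps, continuous F}).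
Implicit Types (x y z v : 'rV[R]_n).

(** The positions that the token can reach: one step from a point of [Omega]
    cannot leave this set. *)
Definition arena : set 'rV[R]_n := Omega `|` outer_strip Omega eps.

Let oO : open Omega. Proof. by have [] := domO. Qed.

Lemma edist_le x (A : set 'rV[R]_n) z : A z -> Defs.edist x A <= enorm (x - z).
Proof.
move=> Az; apply: ge_inf; last by exists z.
by exists 0 => _ [? _ <-]; exact: enorm_ge0.
Qed.

(** A step that leaves [Omega] crosses the boundary, at a point no farther from
    its end than its length. *)
Lemma arena_jump x y : Omega x -> enorm (y - x) <= eps -> arena y.
Proof.
move=> Ox yx; have [Oy|nOy] := pselect (Omega y); first by left.
right; split=> //; have [z bz yz] := boundary_crossing oO Ox nOy.
by apply: le_trans (edist_le _ bz) (le_trans yz yx).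
Qed.

(** A bounded set misses the far points of any ray, and the segment to one of
    them crosses the boundary. *)
Lemma boundary_neq0 : boundary Omega !=set0.
Proof.
have [_ _ [x Ox] [M [Mreal HM]]] := domO.
pose i := Ordinal n_gt0.
pose y : 'rV[R]_n := (`|M| + 1) *: delta_mx ord0 i.
have nOy : ~ Omega y.
  have MM : M < `|M| + 1/2 by have := ler_norm M; lra.
  move=> /(HM _ MM) /=; rewrite /y normrZ ger0_norm ?addr_ge0//.
  have : 1 <= `|delta_mx ord0 i : 'rV[R]_n|.
    rewrite /Num.norm/= mx_normrE.
    have := @le_bigmax _ _ _ 0 (fun j : 'I_1 * 'I_n =>
      `|(delta_mx ord0 i : 'rV[R]_n) j.1 j.2|) (ord0, i).
    by rewrite /= mxE !eqxx normr1.
  move=> d1; have := ler_wpM2l (_ : 0 <= `|M| + 1) d1; have := normr_ge0 M; nra.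
by have [z bz _] := boundary_crossing oO Ox nOy; exists z.
Qed.

Lemma compact_closure_Omega : compact (closure Omega).
Proof.
have [_ _ _ [M [Mreal HM]]] := domO.
apply: bounded_closed_compact; last exact: closed_closure.
exists M; split=> // a Ma x cx.
have cl : closed [set v : 'rV[R]_n | `|v| <= a].
  have clr : closed [set r : R | r <= a] by exact: closed_le.
  by apply: (preimage_closed _ clr) => v _; exact: norm_continuous.
rewrite closure_id in cl.
have : closure [set v : 'rV[R]_n | `|v| <= a] x.
  by apply: closureS cx => v; exact: HM.
by rewrite -cl.
Qed.

Lemma compact_boundary : compact (boundary Omega).
Proof.
rewrite /boundary setDE; apply: compact_closedI.
  exact: compact_closure_Omega.
by apply: open_closedC; exact: open_interior.
Qed.

(** The distance to the boundary, which is compact, is attained; this presents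
    the strip as the projection of a closed set. *)
Lemma outer_stripE x : outer_strip Omega eps x <->
  ~ Omega x /\ exists2 z, boundary Omega z & enorm (x - z) <= eps.
Proof.
split=> -[nO] => [dx|[z bz xz]]; split=> //; last exact: le_trans (edist_le _ bz) xz.
have c : {within boundary Omega, continuous (fun z => enorm (x - z))}.
  apply: continuous_subspaceT => z; under eq_fun do rewrite enormBC.
  exact: enormB_continuous.
have [z bz zmin] := EVT_min_rV boundary_neq0 compact_boundary c.
exists z; first exact/set_mem.
apply: le_trans dx; apply: lb_le_inf.
  by have [w bw] := boundary_neq0; exists (enorm (x - w)); exists w.
by move=> _ [w bw <-]; apply: zmin; exact/mem_set.
Qed.

Lemma closed_outer_strip : closed (outer_strip Omega eps).
Proof.
rewrite (_ : outer_strip _ _ = ~` Omega `&`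
  [set x | exists2 z, boundary Omega z & [set p : 'rV[R]_n * 'rV[R]_n | enorm (p.1 - p.2) <= eps] (x, z)]).
  apply: closedI; first exact: open_closedC.
  apply: closed_projection; first exact: compact_boundary.
  have clr : closed [set r : R | r <= eps] by exact: closed_le.
  apply: (preimage_closed _ clr) => p _.
  apply: (@continuous_comp _ _ _ (fun p : 'rV[R]_n * 'rV[R]_n => p.1 - p.2)).
    apply: (@continuousB R _ _ fst snd).
    exact: cvg_fst.
    exact: cvg_snd.
  exact: continuous_enorm.
by apply/seteqP; split=> x /outer_stripE.
Qed.

Lemma closed_arena : closed arena.
Proof.
rewrite (_ : arena = closure Omega `|` outer_strip Omega eps).
  by apply: closedU; [exact: closed_closure|exact: closed_outer_strip].
apply/seteqP; split=> x [h|h]; [|by right| |by right].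
  by left; exact: subset_closure.
have [Ox|nOx] := pselect (Omega x); first by left.
right; apply/outer_stripE; split=> //; exists x; first by split=> // /interior_subset.
by rewrite subrr enorm0 ltW.
Qed.

Lemma compact_arena : compact arena.
Proof.
apply: bounded_closed_compact; last exact: closed_arena.
have [M [Mr HM]] := compact_bounded compact_closure_Omega.
exists (M + eps); split; first by rewrite realD// num_real.
move=> a Ma x xA; have Mae : M < a - eps by lra.
have {}HM := HM _ Mae.
case: xA => [Ox|/outer_stripE[_ [z [cz _] xz]]].
  have := HM x (subset_closure Ox); rewrite /=; move: eps_gt0; lra.
have := HM z cz => /= zM.
have := le_trans (norm_le_enorm (x - z)) xz => xze.
have := ler_normD (x - z) z; rewrite subrK; lra.
Qed.

(** Adding the lower part of the lateral strip to [Omega] makes both pieces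
    compact. *)
Lemma parabolic_stripE : parabolic_strip Omega T eps =
  outer_strip Omega eps `*` `[- eps ^+ 2, T] `|` arena `*` `[- eps ^+ 2, 0].
Proof.
apply/seteqP; split=> -[x t] [] [/= hx ht].
- by left.
- by right; split=> //; left.
- by left.
case: hx => hx; [right|left]; split=> //=; move: ht; rewrite !in_itv/=; move: T_gt0; lra.
Qed.

Lemma compact_parabolic_strip : compact (parabolic_strip Omega T eps).
Proof.
rewrite parabolic_stripE; apply: compactU; apply: compact_setX.
- by apply: subclosed_compact compact_arena _; [exact: closed_outer_strip|move=> x; right].
- exact: segment_compact.
- exact: compact_arena.
- exact: segment_compact.
Qed.

Lemma boundary_data_bounded : exists2 M : R, 0 < M &
  forall w, parabolic_strip Omega T eps w -> `|F w| <= M.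
Proof.
have /compact_bounded[M [Mr HM]] := continuous_compact F_cont compact_parabolic_strip.
exists (`|M| + 1) => [|w sw]; first by rewrite ltr_wpDl.
apply: (HM (`|M| + 1)); last by exists w.
by have := ler_norm M; lra.
Qed.

(** By continuity of [F] on the strip the set is closed intersected with
    open. *)
Lemma boundary_data_Fsigma (K : set 'rV[R]_n) t c : closed K ->
  (forall x, K x -> parabolic_strip Omega T eps (x, t)) ->
  Fsigma (K `&` [set x | c < F (x, t)]).
Proof.
move=> cK sK.
have og : open [set r : R | c < r] by exact: open_gt.
have FO := (continuousP (F : subspace _ -> _)).1 F_cont.
have [U oU UF] := (open_subspaceP _ _).1 (FO _ og).
rewrite (_ : _ `&` _ = K `&` (fun x => (x, t)) @^-1` U).
  apply: FsigmaI; first exact: closed_Fsigma.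
  apply: open_Fsigma; apply: (open_comp _ oU) => x _.
  apply: (@cvg_pair _ _ _ (nbhs x) (nbhs x) (nbhs t) _ _ _ id (cst t)).
    exact: cvg_id.
  exact: cvg_cst.
apply/seteqP; split=> x [Kx h]; split=> //=; have sx := sK x Kx.
  have : ([set w | c < F w] `&` parabolic_strip Omega T eps) (x, t) by split.
  by rewrite -UF => -[].
have : (U `&` parabolic_strip Omega T eps) (x, t) by split.
by rewrite UF => -[].
Qed.

End arena.

(** * The supremum over directions *)
Section two_point_sup.
Context {R : realType} {n : nat}.
Variables (eps : R) (X Omega : set 'rV[R]_n) (v : 'rV[R]_n -> R) (M : R).
Hypotheses (n_gt0 : (0 < n)%N) (openO : open Omega)
  (jump : forall x s, Omega x -> enorm s = 1 -> X (x + eps *: s))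
  (v_bounded : forall x, X x -> `|v x| <= M)
  (v_Fsigma : forall c, Fsigma (X `&` [set x | c < v x])).
Implicit Types (x y s : 'rV[R]_n).

Definition two_point x s := (v (x + eps *: s) + v (x - eps *: s)) / 2.

Definition two_point_sup x := sup [set two_point x s | s in [set s | enorm s = 1]].

Lemma unit_vector_exists : exists e : 'rV[R]_n, enorm e = 1.
Proof. by exists (delta_mx ord0 (Ordinal n_gt0)); exact: enorm_delta. Qed.

Let jumpN x s : Omega x -> enorm s = 1 -> X (x - eps *: s).
Proof. by move=> Ox s1; rewrite -scalerN; apply: jump; rewrite ?enormN. Qed.

Lemma two_point_bounded x s : Omega x -> enorm s = 1 -> `|two_point x s| <= M.
Proof.
move=> Ox s1; have := v_bounded (jump Ox s1); have := v_bounded (jumpN Ox s1).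
by rewrite /two_point !ler_norml => /andP[? ?] /andP[? ?]; apply/andP; split; lra.
Qed.

Lemma two_point_le_sup x s : Omega x -> enorm s = 1 -> two_point x s <= two_point_sup x.
Proof.
move=> Ox s1; apply: ub_le_sup; last by exists s.
exists M => _ [s' s'1 <-].
by have := two_point_bounded Ox s'1; rewrite ler_norml => /andP[].
Qed.

Lemma two_point_sup_gt x c : Omega x -> c < two_point_sup x ->
  exists2 s, enorm s = 1 & c < two_point x s.
Proof.
move=> Ox cs; have [_ [s s1 <-] cts] : exists2 z, [set two_point x s | s in [set s | enorm s = 1]] z & c < z.
  apply: sup_gt cs.
  by have [e e1] := unit_vector_exists; exists (two_point x e); exists e.
by exists s.
Qed.

Lemma two_point_sup_bounded x : Omega x -> `|two_point_sup x| <= M.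
Proof.
move=> Ox; have [e e1] := unit_vector_exists.
have := two_point_le_sup Ox e1; have := two_point_bounded Ox e1.
rewrite !ler_norml => /andP[h1 h2] h3; apply/andP; split; first lra.
apply: ge_sup; first by exists (two_point x e); exists e.
by move=> _ [s s1 <-]; have := two_point_bounded Ox s1; rewrite ler_norml => /andP[].
Qed.

Definition admissible (C1 C2 : set 'rV[R]_n) x : set 'rV[R]_n :=
  [set s | enorm s = 1] `&` [set s | C1 (x + eps *: s) /\ C2 (x - eps *: s)].

Lemma continuous_shift (a : R) :
  continuous (fun w : 'rV[R]_n * 'rV[R]_n => w.1 + a *: w.2).
Proof.
move=> w; apply: (@continuousD R _ _ fst (fun w : 'rV[R]_n * 'rV[R]_n => a *: w.2)).
  exact: cvg_fst.
apply: (@continuous_comp _ _ _ snd (fun z : 'rV[R]_n => a *: z)).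
  exact: cvg_snd.
exact: scaler_continuous.
Qed.

Lemma closed_admissible_graph C1 C2 : closed C1 -> closed C2 ->
  closed [set w : 'rV[R]_n * 'rV[R]_n | C1 (w.1 + eps *: w.2) /\ C2 (w.1 - eps *: w.2)].
Proof.
move=> c1 c2.
apply: (@closedI _ [set w : 'rV[R]_n * 'rV[R]_n | C1 (w.1 + eps *: w.2)]
  [set w | C2 (w.1 - eps *: w.2)]).
  by apply: (preimage_closed _ c1) => w _; exact: continuous_shift.
rewrite (_ : [set w | _] = (fun w : 'rV[R]_n * 'rV[R]_n => w.1 + (- eps) *: w.2) @^-1` C2).
  by apply: (preimage_closed _ c2) => w _; exact: continuous_shift.
by apply/seteqP; split=> w; rewrite /= scaleNr.
Qed.

Lemma closed_admissible C1 C2 D : closed C1 -> closed C2 -> closed D ->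
  closed [set x | admissible C1 C2 x `&` D !=set0].
Proof.
move=> c1 c2 cD.
rewrite (_ : [set x | _] = [set x | exists2 s, ([set s | enorm s = 1] `&` D) s &
   [set w : 'rV[R]_n * 'rV[R]_n | C1 (w.1 + eps *: w.2) /\ C2 (w.1 - eps *: w.2)] (x, s)]).
  apply: closed_projection; last exact: closed_admissible_graph.
  by apply: compact_closedI => //; exact: compact_sphere.
apply/seteqP; split=> x /=.
  by move=> [s [[s1 Cs] Ds]]; exists s.
by move=> [s [s1 Ds] Cs]; exists s.
Qed.

Lemma compact_admissible C1 C2 x : closed C1 -> closed C2 ->
  compact (admissible C1 C2 x).
Proof.
move=> c1 c2; apply: compact_closedI; first exact: compact_sphere.
have := closed_admissible_graph c1 c2.
have cx : continuous (fun s : 'rV[R]_n => (x, s)).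
  move=> s; apply: (@cvg_pair _ _ _ (nbhs s) (nbhs x) (nbhs s) _ _ _ (cst x) id).
    exact: cvg_cst.
  exact: cvg_id.
by move=> cl; apply: (preimage_closed (f := fun s : 'rV[R]_n => (x, s)) _ cl) => s _; exact: cx.
Qed.

Let piece (r : rat) : nat -> set 'rV[R]_n := s2val (cid2 (v_Fsigma (ratr r))).

Let piece_closed r i : closed (piece r i).
Proof. exact: (s2valP (cid2 (v_Fsigma (ratr r)))). Qed.

Let pieceE r : X `&` [set x | ratr r < v x] = \bigcup_i piece r i.
Proof. exact: (s2valP' (cid2 (v_Fsigma (ratr r)))). Qed.

Let index := ((rat * rat) * (nat * nat))%type.

Let level (i : index) : R := (ratr i.1.1 + ratr i.1.2) / 2.

Let directions (i : index) := admissible (piece i.1.1 i.2.1) (piece i.1.2 i.2.2).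

Let directions_level i x s : directions i x s -> level i < two_point x s.
Proof.
case: i => -[r q] [i j] [_ /= [h1 h2]]; rewrite /level /two_point/=.
have : (X `&` [set x | ratr r < v x]) (x + eps *: s) by rewrite pieceE; exists i.
have : (X `&` [set x | ratr q < v x]) (x - eps *: s) by rewrite pieceE; exists j.
by move=> [_ /= ?] [_ /= ?]; lra.
Qed.

Let level_directions x s c : Omega x -> enorm s = 1 -> c < two_point x s ->
  exists2 i, directions i x s & c < level i.
Proof.
move=> Ox s1 cts; pose d := two_point x s - c.
have d0 : 0 < d by rewrite /d; lra.
(* Each of the two rationals loses less than [d], so their average loses less
   than [d] and stays above [c]. *)
have [r] : exists r : rat, (ratr r : R) \in `]v (x + eps *: s) - d, v (x + eps *: s)[.
  by apply: rat_in_itvoo; lra.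
rewrite in_itv/= => /andP[r1 r2].
have [q] : exists r : rat, (ratr r : R) \in `]v (x - eps *: s) - d, v (x - eps *: s)[.
  by apply: rat_in_itvoo; lra.
rewrite in_itv/= => /andP[q1 q2].
have : (X `&` [set x | ratr r < v x]) (x + eps *: s) by split=> //; exact: jump.
rewrite pieceE => -[i _ Pi].
have : (X `&` [set x | ratr q < v x]) (x - eps *: s) by split=> //; exact: jumpN.
rewrite pieceE => -[j _ Pj].
exists ((r, q), (i, j)); first by [].
rewrite /level/=; move: r1 q1; rewrite /d /two_point; lra.
Qed.

(** The supremum exceeds [c] iff, for some rationals [r] and [q] with average
    above [c], some direction sends the two ends of the jump to the superlevel
    sets of [r] and [q]; splitting those into closed pieces leaves a countable
    union of projections of closed sets. *)
Lemma two_point_sup_Fsigma c : Fsigma (Omega `&` [set x | c < two_point_sup x]).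
Proof.
rewrite (_ : _ `&` _ = Omega `&` \bigcup_(i : index)
  (if c < level i then [set x | directions i x `&` setT !=set0] else set0)).
  apply: FsigmaI; first exact: open_Fsigma.
  apply: Fsigma_countable_bigcup => i; case: ifP => _; last exact: Fsigma0.
  by apply: closed_Fsigma; apply: closed_admissible => //; exact: closedT.
apply/seteqP; split=> x [Ox]; last first.
  move=> [i _]; case: ifP => // ci [s [ds _]]; split=> //=.
  have := two_point_le_sup Ox (proj1 ds); have := directions_level ds; lra.
move=> /(two_point_sup_gt Ox)[s s1 cs]; split=> //.
have [i di ci] := level_directions Ox s1 cs.
by exists i => //; rewrite ci; exists s.
Qed.

(** Each pair of closed pieces of superlevel sets has a Borel selector of
    admissible directions. At [x] the first pair is used that has an admissible
    direction and whose level is within [eta] of the supremum; this is a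
    measurable condition because the supremum is a Borel function. *)
Lemma measurable_near_optimal eta : 0 < eta ->
  exists2 sigma : 'rV[R]_n -> 'rV[R]_n, measurable_fun setT sigma &
    (forall x, enorm (sigma x) = 1) /\
    forall x, Omega x -> two_point_sup x - eta <= two_point x (sigma x).
Proof.
move=> eta0; have [e e1] := unit_vector_exists.
have mO : measurable Omega by exact: open_measurable_rV.
have mts : measurable_fun Omega two_point_sup.
  apply: measurable_fun_superlevel => c.
  by apply: Fsigma_measurable_rV; exact: two_point_sup_Fsigma.
have wK i : weakly_measurable (directions i).
  by move=> C cC; apply: closed_measurable_rV; exact: closed_admissible.
have /choice[sel selP] : forall i : index, exists s : 'rV[R]_n -> 'rV[R]_n,
    measurable_fun setT s /\ forall x, directions i x !=set0 -> directions i x (s x).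
  move=> i; have ci x : compact (directions i x) by exact: compact_admissible.
  have [s ms sP] := measurable_selection ci (wK i).
  by exists s.
pose dom (i : index) := [set x | directions i x `&` setT !=set0] `&`
  (Omega `&` two_point_sup @^-1` `]-oo, level i + eta[).
have mdom i : measurable (dom i).
  apply: measurableI; first by apply: wK; exact: closedT.
  by apply: mts => //; exact: measurable_itv.
have [f mf fP] := measurable_countable_choice e mdom (fun i => (selP i).1).
have selD i x : dom i x -> directions i x (sel i x).
  by move=> [[s [ds _]] _]; apply: (selP i).2; exists s.
exists f => //; split=> x; have [[-> nd]|[i dx ->]] := fP x.
- by [].
- by have [] := selD _ _ dx.
- move=> Ox; exfalso.
  have [|s s1 ss] := @two_point_sup_gt x (two_point_sup x - eta) Ox; first by lra.
  have [i di ci] := level_directions Ox s1 ss.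
  apply: (nd i); split; first by exists s.
  by split=> //=; rewrite in_itv/=; lra.
- move=> Ox; have := directions_level (selD _ _ dx).
  by have [_ [_]] := dx; rewrite /= in_itv/=; lra.
Qed.

End two_point_sup.

(** * Ball averages *)
Section ball_average_theory.
Context {R : realType} {n : nat}.
Variables (eps : R) (eps_gt0 : 0 < eps).
Implicit Types (x : 'rV[R]_n) (f g : 'rV[R]_n -> R).

Let leb := @lebesgue_rV R n.

Definition ball_volume : R := fine (lebesgue_rV (eball (0 : 'rV[R]_n) eps)).

Lemma ball_volumeE x : lebesgue_rV (eball x eps) = ball_volume%:E.
Proof.
rewrite lebesgue_eball_center /ball_volume fineK// ge0_fin_numE//.
exact: lebesgue_eball_fin.
Qed.

Lemma ball_volume_gt0 : 0 < ball_volume.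
Proof. by rewrite -lte_fin -(ball_volumeE 0) lebesgue_eball_gt0. Qed.

Lemma eq_ball_average f g x : (forall y, eball x eps y -> f y = g y) ->
  ball_average eps f x = ball_average eps g x.
Proof.
move=> fg; rewrite /ball_average; congr (_ * _).
by apply: eq_Rintegral => y /set_mem; exact: fg.
Qed.

Lemma measurable_shifted (D : set 'rV[R]_n) g M : measurable_fun setT g ->
  measurable_fun D (fun y => (g y + M)%:E).
Proof.
move=> mg; have mgM : measurable_fun setT (fun y => g y + M).
  by apply: measurable_funD => //; exact: measurable_cst.
apply/measurable_EFinP; exact: (measurable_funTS mgM).
Qed.

(** Adding [M] makes the integrand nonnegative, which gives access to the
    results on nonnegative integrals. *)
Lemma ball_averageE g M x : measurable_fun setT g ->
  (forall y, `|g y| <= M) ->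
  (\int[leb]_(y in eball x eps) (g y + M)%:E)%E =
  (ball_volume * (ball_average eps g x + M))%:E.
Proof.
move=> mg gM; rewrite /ball_average ball_volumeE/=.
have v0 := ball_volume_gt0.
have mB := measurable_eball x eps.
have intg : leb.-integrable (eball x eps) (EFin \o g).
  apply: measurable_bounded_integrable => //.
  - by rewrite /= ball_volumeE ltry.
  - exact: measurable_funTS.
  - by exists M; split; [exact: num_real|move=> a Ma y _ /=; rewrite (le_trans (gM y))// ltW].
have intM : leb.-integrable (eball x eps) (EFin \o cst M).
  apply: measurable_bounded_integrable => //; first by rewrite /= ball_volumeE ltry.
  by exists `|M|; split; [exact: num_real|move=> a Ma y _ /=; exact: ltW].
rewrite mulrDr mulrA mulfV ?gt_eqF// mul1r.
under eq_integral do rewrite EFinD.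
rewrite integralD//= [RHS]EFinD; congr (_ + _)%E.
  by rewrite /Rintegral fineK//; exact: integrable_fin_num.
by rewrite integral_cst//= ball_volumeE -EFinM mulrC.
Qed.

Lemma ball_average_bounded g M x : measurable_fun setT g ->
  (forall y, `|g y| <= M) -> `|ball_average eps g x| <= M.
Proof.
move=> mg gM; have v0 := ball_volume_gt0.
have h y : 0 <= g y + M <= 2 * M.
  by have := gM y; rewrite ler_norml => /andP[? ?]; apply/andP; split; lra.
have lo : (0 <= \int[leb]_(y in eball x eps) (g y + M)%:E)%E.
  by apply: integral_ge0 => y _; rewrite lee_fin; case/andP: (h y).
have hi : (\int[leb]_(y in eball x eps) (g y + M)%:E <= (2 * M * ball_volume)%:E)%E.
  apply: (@le_trans _ _ (\int[leb]_(y in eball x eps) (2 * M)%:E)%E).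
    apply: ge0_le_integral => //.
    - exact: measurable_eball.
    - by move=> y _; rewrite lee_fin; case/andP: (h y).
    - exact: measurable_shifted.
    - by move=> y _; rewrite lee_fin; case/andP: (h y).
  by rewrite integral_cst/= ?ball_volumeE//; exact: measurable_eball.
move: lo hi; rewrite (ball_averageE _ mg gM) !lee_fin pmulr_rge0// => lo.
by rewrite mulrC ler_pM2r// ler_norml => hi; apply/andP; split; lra.
Qed.

Lemma open_ball_average_gt g M c : measurable_fun setT g ->
  (forall y, `|g y| <= M) -> open [set x | c < ball_average eps g x].
Proof.
move=> mg gM; have v0 := ball_volume_gt0.
have := @open_integral_eball R n eps (fun y => (g y + M)%:E)
  (ball_volume * (c + M))%:E.
rewrite (_ : [set x | _] = [set x | c < ball_average eps g x]); last first.
  apply/seteqP; split=> x /=; rewrite (ball_averageE x mg gM) lte_fin;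
  by rewrite ltr_pM2l// ltrD2r.
apply.
  exact: measurable_shifted.
by move=> y; rewrite lee_fin; have := gM y; rewrite ler_norml => /andP[]; lra.
Qed.

End ball_average_theory.

(** * Regularity of the time slices of a solution *)
Section slices.
Context {R : realType} {n : nat}.
Variables (p T eps : R) (Omega : set 'rV[R]_n) (F u : 'rV[R]_n * R -> R).
Hypotheses (n_gt0 : (0 < n)%N) (p_gt2 : 2 < p) (T_gt0 : 0 < T) (eps_gt0 : 0 < eps)
  (domO : bounded_domain Omega)
  (F_cont : {within parabolic_strip Omega T eps, continuous F})
  (u_F : forall z, parabolic_strip Omega T eps z -> u z = F z)
  (u_dpp : forall x t, cylinder Omega T (x, t) -> dpp p eps u x t).
Variables (M : R) (M_ge0 : 0 <= M)
  (FM : forall z, parabolic_strip Omega T eps z -> `|F z| <= M).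
Implicit Types (x y s : 'rV[R]_n).

Local Notation X := (arena Omega eps).
Local Notation slice t := (fun x => u (x, t)).

Lemma weights_gt0 : [/\ 0 < Defs.alpha n p, 0 < Defs.beta n p &
  Defs.alpha n p + Defs.beta n p = 1].
Proof.
have n0 : (0 : R) <= n%:R by [].
have p2 := p_gt2.
have pn : 0 < p + n%:R by lra.
rewrite /Defs.alpha /Defs.beta; split.
- by rewrite divr_gt0//; lra.
- by rewrite divr_gt0//; lra.
- rewrite -mulrDl (_ : p - 2 + (n%:R + 2) = p + n%:R); last by lra.
  by rewrite mulfV ?gt_eqF.
Qed.

Let oO : open Omega. Proof. by have [] := domO. Qed.

Lemma arena_unit_jump x s : Omega x -> enorm s = 1 -> X (x + eps *: s).
Proof.
move=> Ox s1; apply: (arena_jump domO Ox).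
by rewrite addrAC subrr add0r enormZ s1 mulr1 gtr0_norm.
Qed.

Lemma eball_arena x : Omega x -> eball x eps `<=` X.
Proof. by move=> Ox y yx; apply: (arena_jump domO Ox); exact: ltW. Qed.

(** The class of functions that is stable under the dynamic programming
    principle. *)
Definition regular_slice t := (forall x, X x -> `|u (x, t)| <= M) /\
  forall c, Fsigma (X `&` [set x | c < u (x, t)]).

Lemma measurable_arena : measurable X.
Proof. exact: (closed_measurable_rV (closed_arena n_gt0 eps_gt0 domO)). Qed.

Lemma regular_slice_bounded t y : regular_slice t -> `|(slice t \_ X) y| <= M.
Proof.
move=> [b _]; rewrite patchE; case: ifPn => [/set_mem/b//|_].
by rewrite normr0.
Qed.

Lemma regular_slice_measurable t : regular_slice t ->
  measurable_fun setT (slice t \_ X).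
Proof.
move=> [_ Fs]; apply/(measurable_restrictT _ measurable_arena).
apply: measurable_fun_superlevel => c.
exact: Fsigma_measurable_rV.
Qed.

Lemma regular_slice_initial t : - eps ^+ 2 <= t <= 0 -> regular_slice t.
Proof.
move=> t0.
have sX x : X x -> parabolic_strip Omega T eps (x, t).
  by move=> Xx; rewrite (parabolic_stripE Omega eps T_gt0); right; split.
split=> [x Xx|c]; first by rewrite u_F ?FM//; exact: sX.
rewrite (_ : _ `&` _ = X `&` [set x | c < F (x, t)]).
  exact: (boundary_data_Fsigma F_cont _ (closed_arena n_gt0 eps_gt0 domO) sX).
by apply/seteqP; split=> x [Xx]; rewrite /= (u_F (sX x Xx)).
Qed.

Lemma dppE x t : cylinder Omega T (x, t) ->
  u (x, t) = Defs.beta n p * ball_average eps (slice (t - eps ^+ 2) \_ X) x +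
    Defs.alpha n p * two_point_sup eps (slice (t - eps ^+ 2)) x.
Proof.
move=> cxt; rewrite (u_dpp cxt); congr (_ * _ + _).
apply: eq_ball_average => y yx; rewrite patchE mem_set//.
by apply: eball_arena yx; case: cxt.
Qed.

(** Inside [Omega] a weighted sum of the ball average and the two-point supremum
    exceeds [c] iff some rational [r] lies below the average and the supremum
    exceeds what is then missing; both conditions define F_sigma sets. *)
Lemma regular_slice_step t : 0 < t < T -> regular_slice (t - eps ^+ 2) ->
  regular_slice t.
Proof.
move=> tT rs; have [a0 b0 ab1] := weights_gt0; have [rb rF] := rs.
have mg := regular_slice_measurable rs.
have gM y := @regular_slice_bounded _ y rs.
set g := _ \_ _ in mg gM.
have cyl x : Omega x -> cylinder Omega T (x, t).
  by move=> Ox; split=> //=; rewrite in_itv.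
have sS x : outer_strip Omega eps x -> parabolic_strip Omega T eps (x, t).
  move=> Sx; left; split=> //=; rewrite in_itv/=.
  by have := sqr_ge0 eps; case/andP: tT; lra.
split=> [x [Ox|Sx]|c].
- rewrite (dppE (cyl x Ox)) -/g.
  have h1 := ball_average_bounded eps_gt0 x mg gM.
  have h2 := two_point_sup_bounded n_gt0 arena_unit_jump rb Ox.
  apply: le_trans (ler_normD _ _) _; rewrite (normrM (Defs.beta n p)) (normrM (Defs.alpha n p)) (gtr0_norm b0) (gtr0_norm a0).
  have -> : M = Defs.beta n p * M + Defs.alpha n p * M.
    by rewrite -mulrDl addrC ab1 mul1r.
  by apply: lerD; rewrite ler_pM2l.
- by rewrite u_F ?FM//; exact: sS.
pose A (r : rat) := [set x | ratr r < ball_average eps g x].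
pose B (r : rat) := Omega `&` [set x |
  (c - Defs.beta n p * ratr r) / Defs.alpha n p < two_point_sup eps (slice (t - eps ^+ 2)) x].
rewrite (_ : _ `&` _ = (outer_strip Omega eps `&` [set x | c < F (x, t)]) `|`
  \bigcup_r (A r `&` B r)).
  apply: FsigmaU.
    apply: (boundary_data_Fsigma F_cont _ _ sS).
    exact: (closed_outer_strip n_gt0 domO).
  apply: Fsigma_countable_bigcup => r; apply: FsigmaI.
    have oA : open (A r) by exact: (open_ball_average_gt eps_gt0 mg gM).
    exact: (open_Fsigma oA).
  exact: (two_point_sup_Fsigma n_gt0 oO arena_unit_jump rb rF).
apply/seteqP; split=> x.
  move=> [[Ox|Sx] /= cu]; last by left; split=> //=; rewrite -u_F//; exact: sS.
  right; move: cu; rewrite (dppE (cyl x Ox)) -/g => cu.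
  set a := ball_average _ _ _ in cu; set s := two_point_sup _ _ _ in cu.
  have [r] : exists r : rat, (ratr r : R) \in `](c - Defs.alpha n p * s) / Defs.beta n p, a[.
    by apply: rat_in_itvoo; rewrite (ltr_pdivrMr _ _ b0); lra.
  rewrite in_itv/= => /andP[ra1 ra2]; exists r => //; split=> //; split=> //=.
  by move: ra1; rewrite (ltr_pdivrMr _ _ b0) (ltr_pdivrMr _ _ a0) -/s; lra.
move=> [[Sx cF]|[r _ [ar [Ox sr]]]].
  by split; [right|rewrite /= u_F//; exact: sS].
split; first by left.
rewrite /= (dppE (cyl x Ox)) -/g; move: ar sr; rewrite /A /= (ltr_pdivrMr _ _ a0) => ar.
rewrite mulrC => sr; move: ar; rewrite -(ltr_pM2l b0) => ar; lra.
Qed.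

Lemma regular_slice_all t : - eps ^+ 2 <= t < T -> regular_slice t.
Proof.
move=> /andP[t0 tT].
have e2 : 0 < eps ^+ 2 by rewrite exprn_gt0.
have [k tk] : exists k : nat, t <= k%:R * eps ^+ 2.
  exists (Num.truncn (t / eps ^+ 2)).+1; rewrite -ler_pdivrMr//.
  by apply: ltW; exact: truncnS_gt.
elim: k t t0 tT tk => [|k IH] t t0 tT tk.
  by apply: regular_slice_initial; rewrite t0 -(mul0r (eps ^+ 2)).
have [tle0|tgt0] := leP t 0; first by apply: regular_slice_initial; rewrite t0.
apply: regular_slice_step; first by rewrite tgt0.
by apply: IH; move: tk; rewrite ?mulrSr ?mulrDl -?natr1 ?mulrDl ?mul1r; lra.
Qed.

End slices.

(** * Measures and measurable events on plays *)
Section measure_tools.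
Local Open Scope ereal_scope.
Context {R : realType}.

Lemma probability_of_measure d (T : measurableType d)
    (m : {measure set T -> \bar R}) :
  m setT = 1 -> exists P : probability T R, forall A, P A = m A.
Proof.
move=> m1; exists (mnormalize m (dirac point)) => A.
by rewrite /= /mnormalize m1 onee_eq0/= invr1 mule1.
Qed.

Lemma integral_cst_probability d (T : measurableType d) (P : probability T R)
    (c : \bar R) : \int[P]_x c = c.
Proof.
have /(_ c) /= -> := @integral_cst _ _ _ P setT measurableT.
by rewrite -[RHS]mule1; congr (_ * _); exact: probability_setT.
Qed.

(** The complement of [D] is a null set of the restricted measure. *)
Lemma ge0_integral_mrestr d (T : measurableType d)
    (m : {measure set T -> \bar R}) (D : set T) (mD : measurable D)
    (f : T -> \bar R) : measurable_fun setT f -> (forall x, 0 <= f x) ->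
  \int[mrestr m mD]_x f x = \int[m]_(x in D) f x.
Proof.
move=> mf f0; rewrite -(setvU D) ge0_integral_setU//.
- rewrite null_set_integral ?add0e//.
  + apply: eq_measure_integral => A mA AD.
    by rewrite /mrestr/=; congr (m _); apply/setIidPl.
  + exact: measurableC.
  + exact: measurable_funTS.
  + by rewrite /= /mrestr setICl measure0.
- exact: measurableC.
- by rewrite setvU.
- by apply/disj_setPS; rewrite setICl.
Qed.

End measure_tools.

Section plays_measurability.
Context {R : realType} {n : nat}.
Local Notation plays := (@plays R n).

Lemma measurable_play_coord k : measurable_fun setT (fun w : plays => w k).
Proof.
move=> _ A mA; rewrite setTI; apply: sub_sigma_algebra.
by exists k, A.
Qed.

Lemma measurable_play_event k (A : set 'rV[R]_n) :
  measurable A -> measurable [set w : plays | A (w k)].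
Proof.
by move=> mA; have := @measurable_play_coord k measurableT A mA; rewrite setTI.
Qed.

Lemma measurable_start (x : 'rV[R]_n) : measurable [set w : plays | w 0%N = x].
Proof.
apply: (@measurable_play_event 0 [set x]); apply: closed_measurable_rV.
by apply: accessible_closed_set1; apply: hausdorff_accessible; exact: norm_hausdorff.
Qed.

Lemma measurable_history k : measurable_fun setT (fun w : plays => history w k).
Proof.
apply/measurable_fun_tnthP => i.
rewrite (_ : _ \o _ = (fun w : plays => w i)); first exact: measurable_play_coord.
by apply/funext => w /=; rewrite tnth_mktuple.
Qed.

Lemma measurable_history_event k (A : set (k.+1.-tuple 'rV[R]_n)) :
  measurable A -> measurable [set w : plays | A (history w k)].
Proof.
by move=> mA; have := @measurable_history k measurableT A mA; rewrite setTI.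
Qed.

Lemma measurable_fun_plays d (X : measurableType d) (f : X -> plays) :
  (forall k, measurable_fun setT (fun x => f x k)) -> measurable_fun setT f.
Proof.
move=> mf; apply: (measurability _ (erefl (measurable : set (set plays)))).
move=> _ [_ [k [A mA ->]] <-]; rewrite setTI.
by rewrite -[X in measurable X]setTI; exact: mf.
Qed.

Lemma tnth_history (w : plays) k : tnth (history w k) ord_max = w k.
Proof. by rewrite tnth_mktuple. Qed.

End plays_measurability.

(** * The law of one step *)
Section noise.
Local Open Scope ereal_scope.
Context {R : realType} {n : nat}.
Variables (p eps : R) (p_gt2 : (2 < p)%R) (eps_gt0 : (0 < eps)%R).
Implicit Types (x s : 'rV[R]_n).

Local Notation noise := ('rV[R]_n * R)%type.

(** Noise that is uniform in the ball with scalar part 0 gives the random step;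
    noise with vector part 0 and scalar part [eps] or [- eps] gives the two
    steps in the chosen direction. *)
Definition displace x s (z : noise) : 'rV[R]_n := (x + z.1 + z.2 *: s)%R.

Let c1 := (Defs.beta n p / @ball_volume R n eps)%R.
Let c2 := (Defs.alpha n p / 2)%R.

Lemma measurable_displace d (X : measurableType d) (x s : X -> 'rV[R]_n) (z : X -> noise) :
  measurable_fun setT x -> measurable_fun setT s -> measurable_fun setT z ->
  measurable_fun setT (fun w => displace (x w) (s w) (z w)).
Proof.
move=> mx ms mz; apply: measurable_funD_rV.
  by apply: measurable_funD_rV => //; apply: (measurableT_comp _ mz).
by apply: measurable_funZ_rV => //; apply: (measurableT_comp _ mz).
Qed.

(** The image of [mu] under the displacement from [x] in direction [s] is the
    step law, expressed through integrals. *)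
Definition is_noise_law (mu : probability noise R) : Prop :=
  forall x s (f : 'rV[R]_n -> \bar R), measurable_fun setT f -> (forall y, 0 <= f y) ->
  \int[mu]_z f (displace x s z) =
    c1%:E * \int[@lebesgue_rV R n]_(y in eball x eps) f y +
    (c2%:E * f (x + eps *: s)%R + c2%:E * f (x - eps *: s)%R).

Lemma noise_law_exists : exists mu : probability noise R, is_noise_law mu.
Proof.
have [a0 b0 ab1] := @weights_gt0 R n p p_gt2.
have v0 := @ball_volume_gt0 R n eps eps_gt0.
have c10 : (0 <= c1)%R by rewrite /c1 ltW// divr_gt0.
have c20 : (0 <= c2)%R by rewrite /c2 ltW// divr_gt0.
have mB := @measurable_eball R n 0 eps.
have mi : measurable_fun setT (fun v : 'rV[R]_n => (v, 0%R : R)).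
  by apply: measurable_fun_pair; [exact: measurable_id|exact: measurable_cst].
pose m1 := measure_function_pushforward__canonical__measure_function_Measure
  (mrestr (@lebesgue_rV R n) mB) mi.
pose z1 : noise := (0%R, eps); pose z2 : noise := (0%R, (- eps)%R).
pose m := measure_add (mscale (NngNum c10) m1)
  (measure_add (mscale (NngNum c20) (@dirac _ noise z1 R))
     (mscale (NngNum c20) (@dirac _ noise z2 R))).
have mE (f : noise -> \bar R) : measurable_fun setT f -> (forall z, 0 <= f z) ->
    \int[m]_z f z = c1%:E * \int[@lebesgue_rV R n]_(v in eball 0 eps) f (v, 0%R) +
      (c2%:E * f z1 + c2%:E * f z2).
  move=> mf f0.
  rewrite ge0_integral_measure_add// ge0_integral_mscale//.
  rewrite ge0_integral_measure_add// !ge0_integral_mscale//.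
  rewrite !integral_dirac// !diracT !mul1e; congr (_ * _ + _).
  rewrite (ge0_integral_pushforward mi)//= preimage_setT.
  rewrite ge0_integral_mrestr//; exact: measurableT_comp.
have [|mu muE] := @probability_of_measure R _ _ m.
  have := mE (cst 1) (measurable_cst _) (fun=> lee01).
  rewrite integral_cst// mul1e => ->.
  rewrite integral_cst//= mul1e ball_volumeE !mule1 -!EFinM -!EFinD; congr EFin.
  by rewrite /c1 mulfVK ?gt_eqF// /c2 -splitr addrC.
exists mu => x s f mf f0.
transitivity (\int[m]_z f (displace x s z)).
  by apply: eq_measure_integral => A _ _; exact: muE.
rewrite mE//; last first.
  apply: (measurableT_comp mf); apply: measurable_displace => //; exact: measurable_cst.
rewrite /displace/= !addr0 scaleNr; congr (_ * _ + _).
rewrite [RHS]integral_eball_center//.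
by apply: eq_integral => v _; rewrite scale0r addr0.
Qed.

End noise.

Section game_step.
Local Open Scope ereal_scope.
Context {R : realType} {n : nat}.
Variables (Omega : set 'rV[R]_n) (p T eps : R) (S : @strategy R n) (t0 : R).
Hypotheses (eps_gt0 : (0 < eps)%R) (oO : open Omega) (borelS : borel_strategy S).
Local Notation noise := ('rV[R]_n * R)%type.
Local Notation plays := (@plays R n).
Variable mu : probability noise R.
Hypothesis mu_noise : is_noise_law p eps mu.

Definition alive (k : nat) (w : plays) : bool :=
  (w k, game_time eps t0 k) \in cylinder Omega T.

Definition next_position (k : nat) (w : plays) (z : noise) : 'rV[R]_n :=
  if alive k w then displace (w k) (@S k (t0, history w k)) z else w k.

Lemma measurable_alive k : measurable_fun setT (alive k).
Proof.
apply: (measurable_fun_bool true) => //.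
rewrite setTI; have [tT|tT] := boolP (game_time eps t0 k \in `]0%R, T[).
  rewrite (_ : _ @^-1` _ = (fun w : plays => w k) @^-1` Omega).
    rewrite -[X in measurable X]setTI; apply: measurable_play_coord => //.
    exact: open_measurable_rV.
  apply/seteqP; split=> w /=; rewrite /alive.
    by move=> /set_mem[].
  by move=> Ow; apply/mem_set.
rewrite (_ : _ @^-1` _ = set0) //; apply/seteqP; split=> // w /=.
by move=> /set_mem[_ /=]; exact/negP.
Qed.

Lemma measurable_next_position k : measurable_fun setT (fun wz : plays * noise => next_position k wz.1 wz.2).
Proof.
apply: (measurable_fun_ifT (f := fun wz : plays * noise => alive k wz.1)).
- exact: (measurableT_comp (measurable_alive k) measurable_fst).
- apply: measurable_displace; last exact: measurable_snd.
    exact: (measurableT_comp (measurable_play_coord k) measurable_fst).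
  apply: (measurableT_comp (borelS k).1).
  apply: measurable_fun_pair; first exact: measurable_cst.
  have mh := @measurable_history R n k.
  have mf : measurable_fun setT (@fst plays noise) by exact: measurable_fst.
  exact: (measurableT_comp mh mf).
- exact: (measurableT_comp (measurable_play_coord k) measurable_fst).
Qed.

Lemma transition_next_position k w B : measurable B ->
  \int[mu]_z (\1_B (next_position k w z))%:E = transition Omega p T eps S t0 (history w k) B.
Proof.
move=> mB; rewrite /transition tnth_history /next_position -/(alive k w).
case: ifPn => _; last exact: integral_cst_probability.
rewrite (@mu_noise _ _ (fun y => (\1_B y)%:E)) => //; last first.
  by apply/measurable_EFinP; exact: measurable_indic.
rewrite /step_law !ball_volumeE//= EFinM -muleA addeA; congr (_ * _ + _ + _).
rewrite muleC integral_indic//; exact: measurable_eball.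
Qed.

(** The hypothesis on [P] equates the law of the next position on the event
    [A (history w k)] with the image of the product of [P] and the noise,
    restricted to that event, under [next_position]. Equal measures give equal
    integrals, and Fubini's theorem splits the second one. *)
Lemma one_step (P : probability plays R) k (A : set (k.+1.-tuple 'rV[R]_n))
    (f : 'rV[R]_n -> \bar R) :
  (forall B, measurable B ->
     P [set w | A (history w k) /\ B (w k.+1)] =
     \int[P]_(w in [set w | A (history w k)])
       transition Omega p T eps S t0 (history w k) B) ->
  measurable A -> measurable_fun setT f -> (forall y, 0 <= f y) ->
  \int[P]_(w in [set w | A (history w k)]) f (w k.+1) =
  \int[P]_(w in [set w | A (history w k)]) \int[mu]_z f (next_position k w z).
Proof.
move=> law mA mf f0; set D := [set w : plays | A (history w k)].
have mD : measurable D by exact: measurable_history_event.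
have mDT : measurable (D `*` [set: noise]) by exact: measurableX.
have mc := @measurable_play_coord R n k.+1.
have mn := measurable_next_position k.
pose m1 := measure_function_pushforward__canonical__measure_function_Measure
  (mrestr P mD) mc.
pose m2 := measure_function_pushforward__canonical__measure_function_Measure
  (mrestr (P \x mu) mDT) mn.
have fubini (h : 'rV[R]_n -> \bar R) : measurable_fun setT h -> (forall y, 0 <= h y) ->
    \int[m2]_y h y = \int[P]_(w in D) \int[mu]_z h (next_position k w z).
  move=> mh h0.
  have mhn : measurable_fun setT (fun wz : plays * noise => h (next_position k wz.1 wz.2)).
    exact: (measurableT_comp mh mn).
  rewrite (ge0_integral_pushforward mn)//= preimage_setT.
  rewrite (ge0_integral_mrestr _ mDT mhn) => [|z]; last exact: h0.
  rewrite integral_mkcond fubini_tonelli1; last 2 first.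
  - by apply/(measurable_restrictT _ mDT); exact: (measurable_funTS mhn).
  - by move=> z; rewrite patchE; case: ifP.
  rewrite [RHS]integral_mkcond; apply: eq_integral => w _.
  rewrite /fubini_F patchE; case: ifPn => wD.
    apply: eq_integral => z _; rewrite patchE ifT//.
    by apply/mem_set; split => //=; exact/set_mem.
  apply: integral0_eq => z _; rewrite patchE ifF//.
  by apply/negbTE/negP => /set_mem [/= wD' _]; move/negP: wD; apply; exact/mem_set.
have m12 B : measurable B -> m1 B = m2 B.
  move=> mB.
  transitivity (\int[m2]_y (\1_B y)%:E); last by rewrite integral_indic// setIT.
  rewrite fubini; first last.
  - by move=> y; rewrite lee_fin.
  - by apply/measurable_EFinP; exact: measurable_indic.
  transitivity (P [set w | A (history w k) /\ B (w k.+1)]).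
    rewrite /m1/= /pushforward /mrestr setIC; congr (P _).
  rewrite law//; apply: eq_integral => w _; rewrite -transition_next_position//.
transitivity (\int[m1]_y f y); last first.
  rewrite -fubini//; apply: eq_measure_integral => B mB _; exact: m12.
rewrite (ge0_integral_pushforward mc)//= preimage_setT ge0_integral_mrestr//.
exact: (measurableT_comp mf mc).
Qed.

End game_step.

(** * Existence of a law of the game *)
Section existence.
Local Open Scope ereal_scope.
Context {R : realType} {n : nat}.
Variables (Omega : set 'rV[R]_n) (p T eps : R) (S : @strategy R n) (t0 : R).
Hypotheses (p_gt2 : (2 < p)%R) (eps_gt0 : (0 < eps)%R) (oO : open Omega)
  (borelS : borel_strategy S).
Local Notation noise := ('rV[R]_n * R)%type.
Local Notation plays := (@plays R n).

Definition extend (k : nat) (w : plays) (y : 'rV[R]_n) : plays :=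
  fun j => if (j <= k)%N then w j else y.

Lemma extend_le k w y j : (j <= k)%N -> extend k w y j = w j.
Proof. by rewrite /extend => ->. Qed.

Lemma history_extend k w y j : (j <= k)%N -> history (extend k w y) j = history w j.
Proof.
move=> jk; apply: eq_from_tnth => i; rewrite !tnth_mktuple extend_le//.
by rewrite (leq_trans _ jk)// -ltnS.
Qed.

Lemma measurable_extend d (Z : measurableType d) (k : nat) (w : Z -> plays)
    (y : Z -> 'rV[R]_n) : measurable_fun setT w -> measurable_fun setT y ->
  measurable_fun setT (fun z => extend k (w z) (y z)).
Proof.
move=> mw my; apply: measurable_fun_plays => j; rewrite /extend.
case: leqP => _ //.
exact: (measurableT_comp (measurable_play_coord j) mw).
Qed.

(** The law at stage [k.+1] is the image of the product of the law at stage [k]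
    and the noise under [extend]. Expectations of functions of the first [k]
    positions do not change at later stages, so the law at a stage where time
    is nonpositive satisfies all the conditions for the earlier steps. It
    satisfies the others because the play is at rest from that stage on, as
    the transition rule demands. *)
Lemma game_law_exists x0 : exists P : probability plays R,
  game_law Omega p T eps S x0 t0 P.
Proof.
have [mu mu_noise] := @noise_law_exists R n p eps p_gt2 eps_gt0.
pose nx k := @next_position R n Omega T eps S t0 k.
have mnx k := @measurable_next_position R n Omega T eps S t0 oO borelS k.
have step (P : probability plays R) (k : nat) : exists P' : probability plays R,
    forall f : plays -> \bar R, measurable_fun setT f -> (forall w, 0 <= f w) ->
    \int[P']_w f w = \int[P]_w \int[mu]_z f (extend k w (nx k w z)).
  have me : measurable_fun setT (fun wz : plays * noise => extend k wz.1 (nx k wz.1 wz.2)).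
    by apply: measurable_extend; [exact: measurable_fst|exact: mnx].
  pose m := measure_function_pushforward__canonical__measure_function_Measure
    (P \x mu) me.
  have [|P' P'E] := @probability_of_measure R _ _ m.
    rewrite /m/= /pushforward preimage_setT; exact: probability_setT.
  exists P' => f mf f0.
  transitivity (\int[m]_w f w).
    by apply: eq_measure_integral => C _ _; exact: P'E.
  rewrite (ge0_integral_pushforward me)//= preimage_setT fubini_tonelli1//.
  exact: (measurableT_comp mf me).
have /choice[next_law next_lawE] : forall Pk : probability plays R * nat,
  exists P' : probability plays R,
    forall f : plays -> \bar R, measurable_fun setT f -> (forall w, 0 <= f w) ->
    \int[P']_w f w = \int[Pk.1]_w \int[mu]_z f (extend Pk.2 w (nx Pk.2 w z)).
  by move=> [P k]; exact: step.
(* Stage 0 is the play at rest at the starting point. *)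
pose start : plays := fun=> x0.
pose law := fix law (k : nat) : probability plays R :=
  if k is k'.+1 then next_law (law k', k') else (@dirac _ plays start R).
have lawS k (f : plays -> \bar R) : measurable_fun setT f -> (forall w, 0 <= f w) ->
    \int[law k.+1]_w f w = \int[law k]_w \int[mu]_z f (extend k w (nx k w z)).
  exact: (next_lawE (law k, k)).
have stable j k (f : plays -> \bar R) : measurable_fun setT f -> (forall w, 0 <= f w) ->
    (forall i w y, (j <= i)%N -> f (extend i w y) = f w) -> (j <= k)%N ->
    \int[law k]_w f w = \int[law j]_w f w.
  move=> mf f0 fe; elim: k => [|k IH]; first by rewrite leqn0 => /eqP ->.
  rewrite leq_eqVlt => /predU1P[->//|]; rewrite ltnS => jk.
  rewrite lawS// -IH//; apply: eq_integral => w _.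
  transitivity (\int[mu]_z f w); last exact: integral_cst_probability.
  by apply: eq_integral => z _; rewrite fe.
have [N tN] : exists N : nat, (game_time eps t0 N.+1 <= 0)%R.
  exists (Num.truncn (t0 / eps ^+ 2)); rewrite /game_time subr_le0.
  rewrite -ler_pdivrMr ?exprn_gt0//; apply: ltW; exact: truncnS_gt.
have dead k w : (N < k)%N -> alive Omega T eps t0 k w = false.
  move=> Nk; apply/negbTE/negP => /set_mem[_ /=]; rewrite in_itv/= => /andP[+ _].
  apply/negP; rewrite -leNgt (le_trans _ tN)// /game_time lerD2l lerN2.
  by rewrite ler_pM2r ?exprn_gt0// ler_nat.
exists (law N.+1); split.
  have m0 := @measurable_start R n x0.
  have mi : measurable_fun setT (fun w => (\1_[set w : plays | w 0%N = x0] w)%:E : \bar R).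
    by apply/measurable_EFinP; exact: measurable_indic.
  transitivity (\int[law N.+1]_w (\1_[set w : plays | w 0%N = x0] w)%:E).
    by rewrite integral_indic// setIT.
  rewrite (stable 0%N)//.
  rewrite integral_dirac// diracT mul1e indicE mem_set//.
move=> k A B mA mB.
pose hA : set plays := [set w | A (history w k)].
have mhA : measurable hA by exact: measurable_history_event.
pose cB (j : nat) : set plays := [set w | B (w j)].
have mcB j : measurable (cB j) by exact: measurable_play_event.
have mind (C : set plays) : measurable C -> measurable_fun setT (fun w => (\1_C w)%:E : \bar R).
  by move=> mC; apply/measurable_EFinP; exact: measurable_indic.
have mt : measurable_fun setT (fun w : plays => \int[mu]_z (\1_B (nx k w z))%:E).
  have mnB : measurable_fun setT (fun wz : plays * noise => (\1_B (nx k wz.1 wz.2))%:E : \bar R).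
    have mi : measurable_fun setT (fun y => (\1_B y)%:E : \bar R).
      by apply/measurable_EFinP; exact: measurable_indic.
    exact: (measurableT_comp mi (mnx k)).
  by apply: (measurable_fun_fubini_tonelli_F _ mnB) => z; rewrite lee_fin.
rewrite (_ : [set w | _] = hA `&` cB k.+1)//.
transitivity (\int[law N.+1]_w (\1_(hA `&` cB k.+1) w)%:E).
  by rewrite integral_indic ?setIT//; exact: measurableI.
rewrite [RHS]integral_mkcond.
transitivity (\int[law N.+1]_w ((\1_hA w)%:E * \int[mu]_z (\1_B (nx k w z))%:E)); last first.
  apply: eq_integral => w _; rewrite patchE indicE.
  rewrite (_ : (w \in hA) = (w \in [set w | A (history w k)]))//.
  case: ifP => _; last by rewrite mul0e.
  by rewrite mul1e (transition_next_position Omega T S t0 mu_noise).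
have f2m : measurable_fun setT (fun w : plays => (\1_hA w)%:E * \int[mu]_z (\1_B (nx k w z))%:E).
  by apply: emeasurable_funM => //; exact: mind.
have f20 w : 0 <= (\1_hA w)%:E * \int[mu]_z (\1_B (nx k w z))%:E :> \bar R.
  by apply: mule_ge0; rewrite ?lee_fin//; apply: integral_ge0 => z _; rewrite lee_fin.
have mAB : measurable_fun setT (fun w => (\1_(hA `&` cB k.+1) w)%:E : \bar R).
  by apply: mind; exact: measurableI.
have hAext i w y : (k <= i)%N -> (extend i w y \in hA) = (w \in hA).
  move=> ki; have E := history_extend w y ki.
  by apply/idP/idP => /set_mem h; apply/mem_set; move: h; rewrite /hA /mkset E.
have nxext i w y z : (k <= i)%N -> nx k (extend i w y) z = nx k w z.
  by move=> ki; rewrite /nx /next_position /alive history_extend// extend_le.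
have cBE j w : \1_(cB j) w = \1_B (w j) :> R by [].
have [kN|Nk] := leqP k N.
  rewrite (stable k.+1)//; last first.
    move=> i w y ki; rewrite !indicI /= !cBE extend_le//.
    by rewrite !indicE hAext// ltnW.
  rewrite [RHS](stable k _ _ f2m f20 _ (leqW kN)); last first.
    move=> i w y ki; rewrite !indicE hAext//; congr (_ * _).
    by apply: eq_integral => z _; rewrite nxext.
  rewrite lawS//; apply: eq_integral => w _.
  have mz : measurable_fun setT (fun z => (\1_B (nx k w z))%:E : \bar R).
    have mi : measurable_fun setT (fun y => (\1_B y)%:E : \bar R).
      by apply/measurable_EFinP; exact: measurable_indic.
    have mp : measurable_fun setT (fun z : noise => (w, z)).
      by apply: measurable_fun_pair; [exact: measurable_cst|exact: measurable_id].
    exact: (measurableT_comp mi (measurableT_comp (mnx k) mp)).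
  rewrite -ge0_integralZl//.
  apply: eq_integral => z _; rewrite indicI /= EFinM cBE {2}/extend ltnn.
  by rewrite !indicE hAext.
rewrite (lawS _ _ mAB) => [|w]; last by rewrite lee_fin.
rewrite (lawS _ _ f2m f20); apply: eq_integral => w _; apply: eq_integral => z _.
rewrite indicI/= EFinM cBE; congr (_ * _).
set w' := extend _ _ _.
rewrite -[LHS](integral_cst_probability mu); apply: eq_integral => z' _.
rewrite /nx /next_position dead// /w' /extend.
by rewrite leqNgt ltnS (ltnW Nk) /= leqNgt Nk.
Qed.

End existence.

(** * Values along a play *)
Section martingale.
Context {R : realType} {n : nat}.
Variables (p T eps : R) (Omega : set 'rV[R]_n) (F u : 'rV[R]_n * R -> R).
Hypotheses (n_gt0 : (0 < n)%N) (p_gt2 : 2 < p) (T_gt0 : 0 < T) (eps_gt0 : 0 < eps)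
  (domO : bounded_domain Omega)
  (F_cont : {within parabolic_strip Omega T eps, continuous F})
  (u_F : forall z, parabolic_strip Omega T eps z -> u z = F z)
  (u_dpp : forall x t, cylinder Omega T (x, t) -> dpp p eps u x t).
Variables (M : R) (M_ge0 : 0 <= M)
  (FM : forall z, parabolic_strip Omega T eps z -> `|F z| <= M).
Local Notation X := (arena Omega eps).
Local Notation noise := ('rV[R]_n * R)%type.
Local Notation plays := (@plays R n).
Variables (x0 : 'rV[R]_n) (t0 : R).
Hypothesis start : cylinder Omega T (x0, t0).
Local Notation time := (game_time eps t0).
Local Notation regular := (regular_slice eps Omega u M).
Local Notation slice k := (fun x => u (x, time k)).
Variables (N : nat) (N_last : forall k, (k <= N)%N -> - eps ^+ 2 <= time k < T).
Variable mu : probability noise R.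
Hypothesis mu_noise : is_noise_law p eps mu.

Let oO : open Omega. Proof. by have [] := domO. Qed.

Lemma game_timeS k : time k.+1 = time k - eps ^+ 2.
Proof. by rewrite /game_time -natr1 mulrDl mul1r opprD addrA. Qed.

Lemma regular_time k : (k <= N)%N -> regular (time k).
Proof.
by move=> kN; exact: (regular_slice_all n_gt0 p_gt2 T_gt0 eps_gt0 domO F_cont u_F u_dpp M_ge0 FM (N_last kN)).
Qed.

(** Shifting by the bound [M] keeps all the values nonnegative, so that their
    expectations need no integrability condition. *)
Definition shifted_value k (y : 'rV[R]_n) : R := (slice k \_ X) y + M.

Lemma shifted_value_bounds k y : (k <= N)%N -> 0 <= shifted_value k y <= 2 * M.
Proof.
move=> kN; have := regular_slice_bounded M_ge0 y (regular_time kN).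
by rewrite /shifted_value ler_norml => /andP[? ?]; apply/andP; split; lra.
Qed.

Lemma measurable_shifted_value k : (k <= N)%N ->
  measurable_fun setT (shifted_value k).
Proof.
move=> kN.
have mg := regular_slice_measurable n_gt0 eps_gt0 domO (regular_time kN).
by apply: measurable_funD => //; exact: measurable_cst.
Qed.

Lemma shifted_valueE k y : X y -> shifted_value k y = u (y, time k) + M.
Proof. by move=> Xy; rewrite /shifted_value patchE mem_set. Qed.

(** The weights [alpha] and [beta] add up to 1, so the shift by [M] passes
    through the expectation. *)
Lemma expected_value_move k x s : (k < N)%N -> Omega x -> enorm s = 1 ->
  (\int[mu]_z (shifted_value k.+1 (displace x s z))%:E)%E =
  (Defs.beta n p * ball_average eps (slice k.+1 \_ X) x +
   Defs.alpha n p * two_point eps (slice k.+1) x s + M)%:E.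
Proof.
move=> kN Ox s1; have [a0 b0 ab1] := @weights_gt0 R n p p_gt2.
have v0 := @ball_volume_gt0 R n eps eps_gt0.
have mg := regular_slice_measurable n_gt0 eps_gt0 domO (regular_time kN).
have gM y := regular_slice_bounded M_ge0 y (regular_time kN).
rewrite (@mu_noise _ _ (fun y => (shifted_value k.+1 y)%:E)); first last.
- by move=> y; rewrite lee_fin; case/andP: (shifted_value_bounds y kN).
- by apply/measurable_EFinP; exact: measurable_shifted_value.
rewrite (ball_averageE eps_gt0 x mg gM).
have Xp := arena_unit_jump eps_gt0 domO Ox s1.
have Xm : X (x - eps *: s).
  by rewrite -scalerN; apply: (arena_unit_jump eps_gt0 domO Ox); rewrite enormN.
rewrite !shifted_valueE// -!EFinM -!EFinD; congr EFin.
rewrite /two_point; set a := ball_average _ _ _.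
have -> : Defs.beta n p = 1 - Defs.alpha n p by lra.
by field; rewrite gt_eqF.
Qed.

(** The event that the game has not stopped up to stage [k] is expressed through
    the history, the form in which [game_law] takes events. *)
Definition running_histories k : set (k.+1.-tuple 'rV[R]_n) :=
  [set h | forall i : 'I_k.+1, cylinder Omega T (tnth h i, time i)].

Definition running k : set plays := [set w | running_histories (history w k)].

Lemma runningP k w : running k w <-> forall i, (i <= k)%N -> cylinder Omega T (w i, time i).
Proof.
split=> [h i ik|h i]; last by rewrite /history tnth_mktuple; apply: h; rewrite -ltnS.
by have := h (Ordinal (ik : i < k.+1)%N); rewrite /history tnth_mktuple.
Qed.

Lemma measurable_running_histories k : measurable (@running_histories k).
Proof.
rewrite (_ : @running_histories k = \bigcap_(i : 'I_k.+1)
    ((fun h : k.+1.-tuple 'rV[R]_n => tnth h i) @^-1` [set x | cylinder Omega T (x, time i)])).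
  apply: fin_bigcap_measurable => // i _.
  rewrite -[X in measurable X]setTI; apply: measurable_tnth => //.
  have [tT|tT] := boolP (time i \in `]0%R, T[).
    rewrite (_ : [set x | _] = Omega); first exact: open_measurable_rV.
    by apply/seteqP; split=> x; [case|split].
  by rewrite (_ : [set x | _] = set0)//; apply/seteqP; split=> // x [_ /=]; exact/negP.
by apply/seteqP; split=> h hA i; [move=> _|]; apply: hA.
Qed.

Lemma measurable_running k : measurable (running k).
Proof. exact: (measurable_history_event (@measurable_running_histories k)). Qed.

Lemma running_arena k w : running k w -> X (w k).
Proof. by move=> /runningP/(_ k (leqnn k))[Ox _]; left. Qed.

(** The value at the position where the game stops, or at the position at stage
    [k] if the game is still running. *)
Fixpoint stopped_value k (w : plays) : R :=
  if k is k'.+1 then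
    if w \in running k' then shifted_value k (w k) else stopped_value k' w
  else shifted_value 0 (w 0%N).

Lemma stopped_value_running k w : running k w -> stopped_value k w = shifted_value k (w k).
Proof.
case: k => [//|k] /= rk; rewrite mem_set//.
by apply/runningP => i ik; apply: (runningP k.+1 w).1 => //; exact: leqW.
Qed.

Lemma stopped_value_bounds k w : (k <= N)%N -> 0 <= stopped_value k w <= 2 * M.
Proof.
elim: k => [|k IH] kN /=; first exact: shifted_value_bounds.
by case: ifP => _; [exact: shifted_value_bounds|by apply: IH; exact: ltnW].
Qed.

Lemma measurable_stopped_value k : (k <= N)%N -> measurable_fun setT (stopped_value k).
Proof.
have mv i : (i <= N)%N -> measurable_fun setT (fun w : plays => shifted_value i (w i)).
  by move=> iN; exact: (measurableT_comp (measurable_shifted_value iN) (measurable_play_coord i)).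
elim: k => [|k IH] kN /=; first exact: mv.
apply: measurable_fun_ifT; [|exact: mv|by apply: IH; exact: ltnW].
apply: (measurable_fun_bool true); rewrite setTI.
rewrite (_ : _ @^-1` _ = running k); first exact: measurable_running.
by apply/seteqP; split=> w /=; [exact: set_mem|exact: mem_set].
Qed.

Section strategy.
Local Open Scope ereal_scope.
Variables (S : @strategy R n) (borelS : borel_strategy S) (P : probability plays R)
  (law : game_law Omega p T eps S x0 t0 P).

Local Notation EZ k := (\int[P]_w (stopped_value k w)%:E).

Let mZ k (D : set plays) : (k <= N)%N -> measurable_fun D (fun w => (stopped_value k w)%:E).
Proof.
move=> kN; have mz := measurable_stopped_value kN.
by apply/measurable_EFinP; exact: (measurable_funTS mz).
Qed.

Let Z0 k w : (k <= N)%N -> 0 <= (stopped_value k w)%:E.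
Proof. by move=> kN; rewrite lee_fin; case/andP: (stopped_value_bounds w kN). Qed.

(** The conditional expectation, given the play up to stage [k], of the value at
    stage [k.+1] for a game that is still running. *)
Definition conditional_value k (w : plays) : \bar R :=
  \int[mu]_z (shifted_value k.+1 (next_position Omega T eps S t0 k w z))%:E.

Let measurable_shiftedE k : (k <= N)%N ->
  measurable_fun setT (fun y => (shifted_value k y)%:E).
Proof. by move=> kN; apply/measurable_EFinP; exact: measurable_shifted_value. Qed.

Let shiftedE_ge0 k y : (k <= N)%N -> 0 <= (shifted_value k y)%:E.
Proof. by move=> kN; rewrite lee_fin; case/andP: (shifted_value_bounds y kN). Qed.

Lemma conditional_value_ge0 k w : (k < N)%N -> 0 <= conditional_value k w.
Proof. by move=> kN; apply: integral_ge0 => z _; exact: shiftedE_ge0. Qed.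

Lemma measurable_conditional_value k : (k < N)%N -> measurable_fun setT (conditional_value k).
Proof.
move=> kN; have mn := @measurable_next_position R n Omega T eps S t0 oO borelS k.
have mvn := measurableT_comp (measurable_shiftedE kN) mn.
by apply: (measurable_fun_fubini_tonelli_F _ mvn) => z; exact: shiftedE_ge0.
Qed.

Lemma integral_running_next k : (k < N)%N ->
  \int[P]_(w in running k) (stopped_value k.+1 w)%:E = \int[P]_(w in running k) conditional_value k w.
Proof.
move=> kN.
transitivity (\int[P]_(w in running k) (shifted_value k.+1 (w k.+1))%:E).
  by apply: eq_integral => w wr /=; rewrite wr.
have lawk B := law.2 k _ B (@measurable_running_histories k).
by apply: (one_step oO borelS mu_noise lawk (@measurable_running_histories k)
  (measurable_shiftedE kN)) => y; exact: shiftedE_ge0.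
Qed.

Lemma conditional_valueE k w : (k < N)%N -> running k w -> conditional_value k w =
  (Defs.beta n p * ball_average eps (slice k.+1 \_ X) (w k) +
   Defs.alpha n p * two_point eps (slice k.+1) (w k) (@S k (t0, history w k)) + M)%:E.
Proof.
move=> kN wr; have cw := (runningP k w).1 wr k (leqnn k).
have Ow : Omega (w k) by case: cw.
rewrite -expected_value_move//; last by have [_] := borelS k; apply.
by apply: eq_integral => z _; rewrite /next_position /alive mem_set.
Qed.

(** Step [k] changes the stopped value only while the game is running. *)
Lemma stopped_value_split k : (k < N)%N ->
  EZ k = \int[P]_(w in running k) (stopped_value k w)%:E +
         \int[P]_(w in ~` running k) (stopped_value k w)%:E /\
  EZ k.+1 = \int[P]_(w in running k) (stopped_value k.+1 w)%:E +
         \int[P]_(w in ~` running k) (stopped_value k w)%:E.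
Proof.
move=> kN; have mr := measurable_running k; have kN' := ltnW kN.
have split_int j : (j <= N)%N -> EZ j = \int[P]_(w in running k) (stopped_value j w)%:E +
         \int[P]_(w in ~` running k) (stopped_value j w)%:E.
  move=> jN; rewrite -ge0_integral_setU ?setUv//.
  - exact: measurableC.
  - exact: mZ.
  - by move=> w _; exact: Z0.
  - by apply/disj_setPS; rewrite setICr.
split; first exact: split_int.
rewrite split_int//; congr (_ + _); apply: eq_integral => w /set_mem wr /=.
by rewrite memNset.
Qed.

Lemma expected_value_dppE k w : (k < N)%N -> running k w ->
  stopped_value k w = (Defs.beta n p * ball_average eps (slice k.+1 \_ X) (w k) +
     Defs.alpha n p * two_point_sup eps (slice k.+1) (w k) + M)%R.
Proof.
move=> kN wr; rewrite stopped_value_running// shifted_valueE; last exact: running_arena.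
rewrite (dppE domO u_dpp) ?game_timeS//.
by have := (runningP k w).1 wr k (leqnn k).
Qed.

Lemma stopped_value_supermartingale k : (k < N)%N -> EZ k.+1 <= EZ k.
Proof.
move=> kN; have [-> ->] := stopped_value_split kN; apply: leeD2r.
have [a0 b0 ab1] := @weights_gt0 R n p p_gt2.
have mEV := measurable_conditional_value kN; have kN' := ltnW kN.
rewrite integral_running_next//; apply: ge0_le_integral => //.
- exact: measurable_running.
- by move=> w _; exact: conditional_value_ge0.
- exact: (measurable_funTS mEV).
- exact: mZ.
move=> w wr; rewrite conditional_valueE// expected_value_dppE// lee_fin lerD2r lerD2l.
rewrite ler_pM2l//.
apply: (two_point_le_sup (arena_unit_jump eps_gt0 domO) (regular_time kN).1).
  by have := (runningP k w).1 wr k (leqnn k) => -[].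
by have [_] := borelS k; apply.
Qed.

(** The loss [eta] in the choice of the direction is weighted by [alpha], which
    is at most 1. *)
Lemma stopped_value_near_submartingale k (eta : R) : (0 <= eta)%R -> (k < N)%N ->
  (forall w, running k w -> (two_point_sup eps (slice k.+1) (w k) - eta <=
     two_point eps (slice k.+1) (w k) (@S k (t0, history w k)))%R) ->
  EZ k <= EZ k.+1 + eta%:E.
Proof.
move=> eta0 kN near_opt; have [-> ->] := stopped_value_split kN.
have [a0 b0 ab1] := @weights_gt0 R n p p_gt2.
have mEV := measurable_conditional_value kN; have kN' := ltnW kN.
have mr := measurable_running k.
rewrite addeAC; apply: leeD2r; rewrite integral_running_next//.
apply: (@le_trans _ _ (\int[P]_(w in running k) (conditional_value k w + eta%:E))).
  apply: ge0_le_integral => //.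
  - by move=> w _; exact: Z0.
  - exact: mZ.
  - by apply: emeasurable_funD; [exact: (measurable_funTS mEV)|exact: measurable_cst].
  move=> w wr; rewrite conditional_valueE// expected_value_dppE// -EFinD lee_fin.
  have := near_opt w wr; set s1 := two_point_sup _ _ _; set s2 := two_point _ _ _ _ => h.
  have h1 : (Defs.alpha n p * (s1 - s2) <= 1 * eta)%R.
    have [s12|s12] := leP 0%R (s1 - s2)%R; first by apply: ler_pM => //; lra.
    apply: (@le_trans _ _ 0%R); last by rewrite mul1r.
    by rewrite pmulr_rle0// ltW.
  by move: h1; lra.
have -> : \int[P]_(w in running k) (conditional_value k w + eta%:E) =
    \int[P]_(w in running k) conditional_value k w + \int[P]_(w in running k) eta%:E.
  apply: ge0_integralD => //.
  - by move=> w _; exact: conditional_value_ge0.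
  - exact: (measurable_funTS mEV).
apply: leeD2l; have /(_ eta%:E) /= -> := @integral_cst _ _ _ P _ mr.
rewrite -[leRHS]mule1; apply: lee_pmul => //; exact: probability_le1.
Qed.

Lemma expected_stopped_value0 : EZ 0 = (u (x0, t0) + M)%:E.
Proof.
have m0 := @measurable_start R n x0.
have Xx0 : X x0 by left; case: start.
have t00 : time 0 = t0 by rewrite /game_time mul0r subr0.
rewrite -[RHS](integral_cst_probability P); apply: ae_eq_integral => //.
- exact: mZ.
exists (~` [set w : plays | w 0%N = x0]); split.
- exact: measurableC.
- by rewrite [LHS](probability_setC P m0) law.1 subee.
- move=> w /= h; apply: contra_not h => wx _.
  by rewrite /= wx shifted_valueE// t00.
Qed.

Lemma transition_arena k w : X (w k) -> transition Omega p T eps S t0 (history w k) X = 1.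
Proof.
move=> Xw; rewrite /transition tnth_history; case: ifPn => [/set_mem[Ow _]|_]; last first.
  by rewrite diracE mem_set.
have [a0 b0 ab1] := @weights_gt0 R n p p_gt2.
have v0 := @ball_volume_gt0 R n eps eps_gt0.
have s1 : enorm (@S k (t0, history w k)) = 1%R by have [_] := borelS k; apply.
have Xp := arena_unit_jump eps_gt0 domO Ow s1.
have Xm : X (w k - eps *: @S k (t0, history w k))%R.
  by rewrite -scalerN; apply: (arena_unit_jump eps_gt0 domO Ow); rewrite enormN.
rewrite /step_law (setIidr (eball_arena domO Ow)) ball_volumeE/= !diracE.
rewrite !mem_set// !mule1 -!EFinM -!EFinD; congr EFin.
rewrite mulfV ?gt_eqF// mulr1; lra.
Qed.

(** A play may be an arbitrary sequence of points; the transition probabilities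
    confine it almost surely. *)
Lemma arena_almost_sure k : (k <= N)%N -> P [set w | X (w k)] = 1.
Proof.
have mX := measurable_arena n_gt0 eps_gt0 domO.
have mXk j : measurable [set w : plays | X (w j)] by exact: measurable_play_event.
elim: k => [_|k IH kN].
  apply/eqP; rewrite eq_le probability_le1//= -law.1; apply: le_measure; rewrite ?inE//.
    exact: measurable_start.
  by move=> w /= ->; left; case: start.
apply/eqP; rewrite eq_le probability_le1//= -(IH (ltnW kN)).
have lawk B := law.2 k setT B measurableT.
have := lawk _ mX; rewrite (_ : [set w | _] = [set w : plays | X (w k.+1)]); last first.
  by apply/seteqP; split=> w //= [].
move=> ->; rewrite (_ : [set w | [set: _] _] = setT)//.
rewrite -[X in P X]setIT -integral_indic//; apply: ge0_le_integral => //.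
- by apply/measurable_EFinP; exact: measurable_indic.
- rewrite (_ : (fun w => _) =
      (fun w : plays => \int[mu]_z (\1_X (next_position Omega T eps S t0 k w z))%:E)).
    have mi : measurable_fun setT (fun y => (\1_X y)%:E : \bar R).
      by apply/measurable_EFinP; exact: measurable_indic.
    have mn := @measurable_next_position R n Omega T eps S t0 oO borelS k.
    have min := measurableT_comp mi mn.
    by apply: (measurable_fun_fubini_tonelli_F _ min) => z; rewrite lee_fin.
  by apply/funext => w; rewrite (transition_next_position Omega T S t0 mu_noise _ _ mX).
move=> w _; rewrite indicE; have [/set_mem Xw|_] := boolP (w \in _); last first.
  rewrite -(transition_next_position Omega T S t0 mu_noise _ _ mX).
  by apply: integral_ge0 => z _; rewrite lee_fin.
by rewrite transition_arena.
Qed.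

(** While the token stays in the arena, being in the strip is the negation of
    being in the cylinder. Hence the stopping time is the stage at which the
    stopped value freezes, and there [u] equals [F]. *)
Lemma payoff_good w : (forall k, (k <= N)%N -> X (w k)) -> (time N <= 0)%R ->
  (payoff Omega T eps F t0 w = stopped_value N w - M)%R.
Proof.
move=> wX tN.
have stripE k : (k <= N)%N -> in_strip Omega T eps t0 w k <-> ~ cylinder Omega T (w k, time k).
  move=> kN; have /andP[t1 t2] := N_last kN; split.
    move=> /asboolP; rewrite (parabolic_stripE Omega eps T_gt0).
    move=> [[[nO _] _] [Oy _]//|[_ /=]]; rewrite in_itv/= => /andP[_ t3] [_ /=].
    by rewrite in_itv/= ltNge t3.
  move=> ncyl; apply/asboolP; rewrite (parabolic_stripE Omega eps T_gt0).
  have [t3|t3] := leP (time k) 0%R.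
    by right; split; [exact: wX|rewrite /= in_itv/= t1].
  left; split; last by rewrite /= in_itv/= t1 ltW.
  have [Oy|//] := wX k kN; exfalso; apply: ncyl; split=> //=.
  by rewrite in_itv/= t3.
have stN : in_strip Omega T eps t0 w N.
  by apply/stripE => // -[_ /=]; rewrite in_itv/= ltNge tN.
rewrite /payoff /stopping_time; case: pselect => [ex|[]]; last by exists N.
case: ex_minnP => m sm mmin; have mN := mmin N stN.
have mst k : (m <= k <= N)%N -> stopped_value k w = shifted_value m (w m).
  move=> /andP[mk kN]; elim: k mk kN => [|k IH].
    by rewrite leqn0 => /eqP -> _.
  rewrite leq_eqVlt => /predU1P[<- _|].
    case: {-2}m (erefl m) => [//|m' mE] /=.
    rewrite mem_set//; apply/runningP => i im; apply: contrapT => ncyl.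
    have iN : (i <= N)%N by apply: leq_trans mN; rewrite -mE ltnW.
    by have := mmin i ((stripE i iN).2 ncyl); rewrite -mE ltnNge im.
  rewrite ltnS => mk kN /=; rewrite memNset; first exact/IH/ltnW.
  by move=> /runningP/(_ m mk); exact: (stripE m mN).1.
rewrite mst ?mN ?leqnn// shifted_valueE; last exact: wX.
by rewrite addrK u_F//; exact/asboolP.
Qed.

(** The stopping stages partition the plays into measurable events, and the
    sections of the strip are closed sets on which [F] is Borel. *)
Lemma measurable_payoff : measurable_fun setT (payoff Omega T eps F t0).
Proof.
pose slab k : set 'rV[R]_n := [set x | parabolic_strip Omega T eps (x, time k)].
have cslab k : closed (slab k).
  pose A := if `[< (- eps ^+ 2 <= time k <= T)%R >] then outer_strip Omega eps else set0.
  pose B := if `[< (- eps ^+ 2 <= time k <= 0)%R >] then X else set0.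
  rewrite (_ : slab k = A `|` B).
    apply: closedU; rewrite /A /B; case: asboolP => _; try exact: closed0.
      exact: (closed_outer_strip n_gt0 domO).
    exact: (closed_arena n_gt0 eps_gt0 domO).
  rewrite /slab (parabolic_stripE Omega eps T_gt0) /A /B; apply/seteqP; split=> x.
    move=> [[Sx /=]|[Xx /=]]; rewrite in_itv/= => tt; [left|right].
      by rewrite asboolT.
    by rewrite asboolT.
  move=> []; case: asboolP => // tt Hx; [left|right]; split=> //=; rewrite in_itv//.
have mslab k := closed_measurable_rV (cslab k).
pose dom k : set plays := [set w | slab k (w k)].
have mdom k : measurable (dom k) by exact: measurable_play_event.
apply: (measurable_glue (dom := dom) (s := fun k w => F (w k, time k)) (y0 := 0%R)) => //.
- move=> k; have mF : measurable_fun (slab k) (fun x => F (x, time k)).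
    apply: measurable_fun_superlevel => c; apply: Fsigma_measurable_rV.
    exact: (boundary_data_Fsigma F_cont _ (cslab k)).
  apply: (measurable_comp (F := slab k) (mslab k) _ mF); first by move=> _ [w dw <-].
  exact: (measurable_funTS (measurable_play_coord k)).
- move=> k w dk nj; rewrite /payoff /stopping_time; case: pselect => [ex|[]]; last first.
    by exists k; exact/asboolP.
  case: ex_minnP => m sm mmin; have dm : dom m w by exact/asboolP.
  have mk : (m <= k)%N by apply: mmin; exact/asboolP.
  suff -> : m = k by [].
  by apply/eqP; rewrite eqn_leq mk leqNgt; apply/negP => /nj; exact.
- move=> w nd; rewrite /payoff /stopping_time; case: pselect => // -[k sk].
  by case: (nd k); exact/asboolP.
Qed.

Lemma expected_payoff : (time N <= 0)%R ->
  'E_P[payoff Omega T eps F t0] = EZ N - M%:E.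
Proof.
move=> tN; rewrite unlock.
have mX := measurable_arena n_gt0 eps_gt0 domO.
have mXk j : measurable [set w : plays | X (w j)] by exact: measurable_play_event.
have arena_ae : \forall w \ae P, forall k, (k <= N)%N -> X (w k).
  apply: ae_foralln => k; exists (if (k <= N)%N then ~` [set w : plays | X (w k)] else set0).
  case: leqP => kN; split => //.
  - exact: measurableC.
  - by rewrite [LHS](probability_setC P (mXk k)) arena_almost_sure// subee.
  - by move=> w /= nX Xw; apply: nX.
  - by move=> w /= nX; exfalso; apply: nX.
have mS := measurable_stopped_value (leqnn N).
have mM : measurable_fun setT (fun w => stopped_value N w - M)%R.
  by apply: measurable_funB => //; exact: measurable_cst.
transitivity (\int[P]_w (stopped_value N w - M)%:E).
  apply: ae_eq_integral => //.
  - by apply/measurable_EFinP; exact: measurable_payoff.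
  - exact/measurable_EFinP.
  case: arena_ae => A [mA A0 AB]; exists A; split=> // w /= nw.
  by apply: AB => /= wX; apply: nw => _; rewrite payoff_good.
under eq_integral do rewrite EFinB.
rewrite integralB_EFin//.
- by congr (_ - _); exact: integral_cst_probability.
- apply: measurable_bounded_integrable => //; first by rewrite (le_lt_trans (probability_le1 P _))// ltry.
  exists (2 * M)%R; split; first exact: num_real.
  move=> a Ma w _ /=; have /andP[h1 h2] := stopped_value_bounds w (leqnn N).
  by rewrite ger0_norm// (le_trans h2)// ltW.
- apply: measurable_bounded_integrable => //; first by rewrite (le_lt_trans (probability_le1 P _))// ltry.
  by exists `|M|%R; split; [exact: num_real|move=> a Ma w _ /=; exact: ltW].
Qed.

Lemma expected_payoff_le : (time N <= 0)%R ->
  'E_P[payoff Omega T eps F t0] <= (u (x0, t0))%:E.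
Proof.
move=> tN; rewrite expected_payoff// leeBlDr// -EFinD -expected_stopped_value0.
elim: {-2}N (leqnn N) => // k IH kN.
exact: le_trans (stopped_value_supermartingale kN) (IH (ltnW kN)).
Qed.

Lemma expected_payoff_ge (eta : R) : (0 <= eta)%R -> (time N <= 0)%R ->
  (forall k w, (k < N)%N -> running k w ->
     (two_point_sup eps (slice k.+1) (w k) - eta <=
      two_point eps (slice k.+1) (w k) (@S k (t0, history w k)))%R) ->
  (u (x0, t0))%:E <= 'E_P[payoff Omega T eps F t0] + (N%:R * eta)%:E.
Proof.
move=> eta0 tN near_opt; rewrite expected_payoff//.
rewrite addeAC leeBrDr// -EFinD -expected_stopped_value0.
suff key k : (k <= N)%N -> EZ 0 <= EZ k + (k%:R * eta)%:E by exact: key.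
elim: k => [|k IH] kN; first by rewrite mul0r adde0.
apply: le_trans (IH (ltnW kN)) _.
have -> : (k.+1%:R * eta = eta + k%:R * eta)%R by rewrite -natr1; ring.
rewrite EFinD addeA; apply: leeD2r.
by apply: stopped_value_near_submartingale => // w; exact: near_opt.
Qed.

End strategy.

(** Time is deterministic, so a strategy may use at stage [k] the near-optimal
    direction field of the slice at that time, evaluated at the current
    position. *)
Lemma near_optimal_strategy (eta : R) : 0 < eta ->
  exists2 S : @strategy R n, borel_strategy S &
    forall k w, (k < N)%N -> running k w ->
     two_point_sup eps (slice k.+1) (w k) - eta <=
     two_point eps (slice k.+1) (w k) (@S k (t0, history w k)).
Proof.
move=> eta0.
have /choice[sigma sigmaP] : forall k, exists sigma : 'rV[R]_n -> 'rV[R]_n,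
    [/\ measurable_fun setT sigma, forall x, enorm (sigma x) = 1 &
     (k < N)%N -> forall x, Omega x -> two_point_sup eps (slice k.+1) x - eta <=
       two_point eps (slice k.+1) x (sigma x)].
  move=> k; have [kN|kN] := ltnP k N.
    have [rb rF] := regular_time kN.
    have [s ms [s1 sopt]] := measurable_near_optimal n_gt0 oO
      (arena_unit_jump eps_gt0 domO) rb rF eta0.
    by exists s.
  have [e e1] := unit_vector_exists (R := R) n_gt0.
  by exists (cst e); split.
exists (fun k z => sigma k (tnth z.2 ord_max)) => [k|k w kN rw].
  have [ms s1 _] := sigmaP k; split=> [|h]; last exact: s1.
  apply: (measurableT_comp ms).
  have mt := @measurable_tnth _ 'rV[R]_n k.+1 ord_max.
  exact: (measurableT_comp mt measurable_snd).
rewrite [in X in _ <= X]tnth_history; have [_ _] := sigmaP k; apply=> //.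
by have [] := (runningP k w).1 rw k (leqnn k).
Qed.

End martingale.

(** At the first stage with nonpositive time the previous time was positive, so
    time has not fallen below [- eps ^+ 2]. *)
Lemma last_stage_exists {R : realType} (T eps t0 : R) : 0 < eps -> 0 < t0 < T ->
  exists N : nat, game_time eps t0 N <= 0 /\
    forall k, (k <= N)%N -> - eps ^+ 2 <= game_time eps t0 k < T.
Proof.
move=> eps0 /andP[t00 t0T]; have e2 : 0 < eps ^+ 2 by rewrite exprn_gt0.
have ex : exists N : nat, game_time eps t0 N <= 0.
  exists (Num.truncn (t0 / eps ^+ 2)).+1; rewrite /game_time subr_le0.
  by rewrite -ler_pdivrMr//; apply: ltW; exact: truncnS_gt.
case: (ex_minnP ex) => N tN Nmin; exists N; split=> // k kN.
have tNk : game_time eps t0 N <= game_time eps t0 k.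
  by rewrite /game_time lerD2l lerN2 ler_pM2r// ler_nat.
have tN2 : - eps ^+ 2 <= game_time eps t0 N.
  case: N tN Nmin {kN tNk} => [|N] tN Nmin.
    by move: tN; rewrite /game_time mul0r subr0 leNgt t00.
  have : 0 < game_time eps t0 N.
    by rewrite ltNge; apply/negP => /Nmin; rewrite ltnn.
  by rewrite game_timeS; lra.
apply/andP; split; first exact: le_trans tNk.
apply: le_lt_trans t0T; rewrite /game_time gerBl.
by rewrite mulr_ge0// ltW.
Qed.

Theorem lemma3p4 (R : realType) (n : nat) (p T eps : R)
    (Omega : set 'rV[R]_n) (F u : 'rV[R]_n * R -> R)
    (n_gt0 : (0 < n)%N) (p_gt2 : 2 < p) (T_gt0 : 0 < T) (eps_gt0 : 0 < eps)
    (Omega_domain : bounded_domain Omega)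
    (Omega_sphere : exterior_sphere Omega)
    (F_cont : {within parabolic_strip Omega T eps, continuous F})
    (u_dpp : dpp_solution Omega p T eps F u) :
  forall x t, cylinder Omega T (x, t) ->
    (u (x, t))%:E = game_value Omega p T eps F x t.
Proof.
move=> x t xt; have [_ u_F u_eq] := u_dpp.
have [M M_gt0 FM] := boundary_data_bounded n_gt0 T_gt0 eps_gt0 Omega_domain F_cont.
have M_ge0 := ltW M_gt0.
have [mu mu_noise] := @noise_law_exists R n p eps p_gt2 eps_gt0.
have tT : 0 < t < T by have [_ /=] := xt; rewrite in_itv.
have [N [tN N_last]] := last_stage_exists eps_gt0 tT.
have oO : open Omega by have [] := Omega_domain.
apply/eqP; rewrite eq_le; apply/andP; split; last first.
  apply: ge_ereal_sup => _ [S [P [bS law ->]]].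
  exact: (expected_payoff_le n_gt0 p_gt2 T_gt0 eps_gt0 Omega_domain F_cont u_F u_eq
    M_ge0 FM xt N_last mu_noise bS law).
apply/lee_addgt0Pr => e e_gt0.
(* The error is shared among the steps; [N.+1] rather than [N] keeps the
   denominator positive. *)
have eta_gt0 : 0 < e / N.+1%:R by rewrite divr_gt0.
have [S bS opt] := near_optimal_strategy n_gt0 p_gt2 T_gt0 eps_gt0 Omega_domain F_cont
  u_F u_eq M_ge0 FM N_last eta_gt0.
have [P law] := game_law_exists T t p_gt2 eps_gt0 oO bS x.
have := expected_payoff_ge n_gt0 p_gt2 T_gt0 eps_gt0 Omega_domain F_cont u_F u_eq
  M_ge0 FM xt N_last mu_noise bS law (ltW eta_gt0) tN opt.
move=> /le_trans; apply; apply: leeD.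
  by apply: ereal_sup_ubound; exists S, P.
rewrite lee_fin mulrCA ger_pMr// ler_pdivrMr// mul1r ler_nat.
exact: leqnSn.
Qed.
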